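(* Consider a system of $N$ qubits placed on the sites of a lattice, with a target Hamiltonian $H$ and an actual Hamiltonian $$H' = H + \sum_{i=1}^M g_i V_i,$$ where $M=\mathcal{O}(N)$, each $V_i$ is a local Hermitian operator with $\|V_i\|\le 1$, and $g_1,\dots,g_M$ are independent $\chi$-deformed Gaussian random variables with parameters $\delta>0$ and $\Gamma\in(0,+\infty]$. Suppose $\sqrt{N}t\delta\le 1$. Then for any density matrix $\rho$ and observable $O$, with $O'(t)=e^{iH't}Oe^{-iH't}$, $$\big|\mathrm{tr}[\rho O'(t)] - \mathbb{E}[\mathrm{tr}[\rho O'(t)]]\big| \le 2a\|O\|\sqrt{M}t\delta = \mathcal{O}(a\|O\|\sqrt{N}t\delta)$$ with probability at least $1-2e^{-ca^2}$, for arbitrary $a>0$ and some absolute constant $c>0$.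
   Context: A random variable $g$ is a $\chi$-deformed Gaussian random variable (with parameters $\delta>0$, $\Gamma\in(0,+\infty]$) if $g=\chi(\theta)$ for some $\theta\sim\mathcal{N}(0,1)$, where $\chi:\mathbb{R}\to\mathbb{R}$ is a strictly monotonically increasing differentiable function with $|\mathrm{d}\chi(\theta)/\mathrm{d}\theta|\le\delta$ for all $\theta$, $\chi(0)=0$, $\lim_{\theta\to+\infty}\chi(\theta)=\Gamma$, $\lim_{\theta\to-\infty}\chi(\theta)=-\Gamma$, and $\mathbb{E}[\chi(\theta)]=0$. Independence of the $g_i$ means the underlying Gaussians $\theta_i$ are independent; the expectation is over $\{g_i\}$. $\|\cdot\|$ denotes the operator norm. The $\mathcal{O}(\cdot)$ notation hides constants independent of $N$, $t$, $\delta$, $a$, $\rho$, $O$. *)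

(* Defs.v *)
From HB Require Import structures.
From mathcomp Require Import all_boot all_order all_algebra.
From mathcomp Require Import all_classical all_reals all_analysis.
From mathcomp Require Import complex.

Set Implicit Arguments.
Unset Strict Implicit.
Unset Printing Implicit Defensive.

Import Order.TTheory GRing.Theory Num.Theory.
Import numFieldTopology.Exports numFieldNormedType.Exports.
Local Open Scope classical_set_scope.
Local Open Scope ring_scope.

Section QuantumDefs.
Context {R : realType}.

Definition cconj (z : R[i]) : R[i] := Complex (complex.Re z) (- complex.Im z).
Definition cabs (z : R[i]) : R := Num.sqrt (complex.Re z ^+ 2 + complex.Im z ^+ 2).

Definition adjmx m n (A : 'M[R[i]]_(m, n)) : 'M[R[i]]_(n, m) :=
  (map_mx cconj A)^T.

Definition is_hermitian n (A : 'M[R[i]]_n) : Prop := adjmx A = A.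

Definition vnorm n (v : 'cV[R[i]]_n) : R :=
  Num.sqrt (\sum_(i < n) (complex.Re (v i 0) ^+ 2 + complex.Im (v i 0) ^+ 2)).

Definition opnorm n (A : 'M[R[i]]_n) : R :=
  sup [set vnorm (A *m v) | v in [set v : 'cV[R[i]]_n | vnorm v <= 1]].

Definition psd n (A : 'M[R[i]]_n) : Prop :=
  forall v : 'cV[R[i]]_n,
    complex.Im ((adjmx v *m A *m v) 0 0) = 0 /\ 0 <= complex.Re ((adjmx v *m A *m v) 0 0).

Definition density_matrix n (rho : 'M[R[i]]_n) : Prop :=
  [/\ is_hermitian rho, psd rho & \tr rho = 1].

(* matrix power (n need not be of the form k.+1) *)
Definition mxpow n (A : 'M[R[i]]_n) (k : nat) : 'M[R[i]]_n :=
  iter k (mulmx A) 1%:M.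

Definition expm_partial n (A : 'M[R[i]]_n) (K : nat) : 'M[R[i]]_n :=
  \sum_(k < K) ((k`!)%:R^-1 : R[i]) *: mxpow A k.

Definition expm n (A : 'M[R[i]]_n) : 'M[R[i]]_n :=
  \matrix_(i, j) Complex (limn (fun K => complex.Re (expm_partial A K i j)))
                         (limn (fun K => complex.Im (expm_partial A K i j))).

Definition heisenberg n (H O : 'M[R[i]]_n) (t : R) : 'M[R[i]]_n :=
  expm (Complex 0 t *: H) *m O *m expm (Complex 0 (- t) *: H).

Definition chi_deform (delta : R) (Gamma : \bar R) (chi : R -> R) : Prop :=
  [/\ {homo chi : x y / x < y},
      (forall x, derivable chi x 1),
      (forall x, `| derive1 chi x | <= delta) &
      chi 0 = 0] /\
  ((fun x => (chi x)%:E) @ +oo%R --> Gamma) /\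
  ((fun x => (chi x)%:E) @ -oo%R --> (- Gamma)%E).

Definition mutually_independent d (T : measurableType d)
  (P : probability T R) M (X : 'I_M -> T -> R) : Prop :=
  forall A : 'I_M -> set R, (forall i, measurable (A i)) ->
    P (\bigcap_(i in [set: 'I_M]) (X i @^-1` A i)) =
    (\prod_(i < M) fine (P (X i @^-1` A i)))%:E.

Definition std_normal d (T : measurableType d) (P : probability T R)
  (X : T -> R) : Prop :=
  forall A : set R, measurable A -> P (X @^-1` A) = normal_prob 0 1 A.

End QuantumDefs.

(* Main.v *)
Require Import Defs.
From HB Require Import structures.
From mathcomp Require Import all_boot all_order all_algebra.
From mathcomp Require Import all_classical all_reals all_analysis.
From mathcomp Require Import measurable_realfun spectral complex ring lra.

(* Changing one Gaussian from x to y changes the Hamiltonian by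
   (chi_i x - chi_i y) V_i.  Since |exp (i t A) - exp (i t B)| <= t |A - B| for
   Hermitian A and B, the expectation value then moves by at most b |x - y|,
   where b = 2 |O| t delta; this coordinatewise Lipschitz bound is all that the
   probabilistic part needs.  If f is b-Lipschitz and G is a standard Gaussian,
   Jensen's inequality and the monotonicity of cosh on the symmetrized
   exponential give
     E exp (l (f G - E f G)) <= E exp (l f G) E exp (- l f G)
                             <= E exp (l b G) E exp (- l b G) = exp (l^2 b^2).
   Integrating out one coordinate at a time bounds the centred moment generating
   function of M coordinates by exp (M l^2 b^2), and Chernoff's bound at
   l = a / (2 b sqrt M) yields the constant c = 1 / 4. *)

Import Order.TTheory GRing.Theory Num.Theory.
Import numFieldTopology.Exports numFieldNormedType.Exports.
Local Open Scope classical_set_scope.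
Local Open Scope ring_scope.

Set Implicit Arguments.
Unset Strict Implicit.
Unset Printing Implicit Defensive.

(** * Vector and operator norms *)

Section EuclideanNorm.
Context {R : realType}.
Local Notation C := R[i].

(** The Lipschitz constant must be free of the dimension, whereas the Taylor remainders of the two
    exponentials depend on their spectra. Cutting the time into [k] equal pieces and letting [k]
    grow removes the remainders, because unitarity makes the [k] errors add instead of multiply. The
    coordinates can be integrated out one by one because averaging over a coordinate preserves the
    range, the mean and every coordinatewise Lipschitz bound. The expectation value is shifted by
    |O| to be nonnegative and bounded. Every integral then has a nonnegative integrand, so Tonelli
    and additivity apply directly, and the integrals that matter are real numbers. Measurability in
    the noise is not free, since the matrix exponential is an entrywise limit: it follows from the
    convergence of the exponential series, which the spectral theorem reduces to scalar series. *)

Definition cplx (x : R) : C := Complex x 0.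

Lemma cconjE (z : C) : cconj z = (z^*)%R.
Proof. by case: z. Qed.

Lemma adjmxE m n (A : 'M[C]_(m, n)) : adjmx A = map_mx Num.conj (A^T).
Proof. by apply/matrixP => i j; rewrite !mxE cconjE. Qed.

Lemma adjmxK m n (A : 'M[C]_(m, n)) : adjmx (adjmx A) = A.
Proof. by apply/matrixP => i j; rewrite !mxE !cconjE conjCK. Qed.

Lemma adjmxM m n p (A : 'M[C]_(m, n)) (B : 'M[C]_(n, p)) :
  adjmx (A *m B) = adjmx B *m adjmx A.
Proof. by rewrite !adjmxE trmx_mul map_mxM. Qed.

Lemma adjmxD m n (A B : 'M[C]_(m, n)) : adjmx (A + B) = adjmx A + adjmx B.
Proof. by rewrite !adjmxE linearD /= map_mxD. Qed.

Lemma adjmxZ m n c (A : 'M[C]_(m, n)) : adjmx (c *: A) = cconj c *: adjmx A.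
Proof. by rewrite !adjmxE linearZ /= map_mxZ cconjE. Qed.

Lemma cReD (x y : C) : complex.Re (x + y) = complex.Re x + complex.Re y.
Proof. by case: x y => [? ?] [? ?]. Qed.
Lemma cImD (x y : C) : complex.Im (x + y) = complex.Im x + complex.Im y.
Proof. by case: x y => [? ?] [? ?]. Qed.
Lemma cReN (x : C) : complex.Re (- x) = - complex.Re x.
Proof. by case: x. Qed.
Lemma cReM (x y : C) :
  complex.Re (x * y) = complex.Re x * complex.Re y - complex.Im x * complex.Im y.
Proof. by case: x y => [? ?] [? ?]. Qed.
Lemma cImM (x y : C) :
  complex.Im (x * y) = complex.Re x * complex.Im y + complex.Im x * complex.Re y.
Proof. by case: x y => [? ?] [? ?] /=; rewrite addrC. Qed.
Lemma cRe_sum (I : finType) (f : I -> C) :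
  complex.Re (\sum_i f i) = \sum_i complex.Re (f i).
Proof. by apply: (big_morph (@complex.Re R)) => //; exact: cReD. Qed.
Lemma cIm_sum (I : finType) (f : I -> C) :
  complex.Im (\sum_i f i) = \sum_i complex.Im (f i).
Proof. by apply: (big_morph (@complex.Im R)) => //; exact: cImD. Qed.

(** The Euclidean inner product of C^n viewed as R^(2n). It induces [vnorm], and keeping only the
    real part avoids complex scalars in every estimate. *)
Definition rdot n (u v : 'cV[C]_n) : R := complex.Re ((adjmx u *m v) 0 0).

Lemma rdotE n (u v : 'cV[C]_n) : rdot u v =
  \sum_i (complex.Re (u i 0) * complex.Re (v i 0) +
          complex.Im (u i 0) * complex.Im (v i 0)).
Proof.
rewrite /rdot mxE cRe_sum; apply: eq_bigr => i _.
by rewrite !mxE cReM /= mulNr opprK.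
Qed.

Lemma rdotC n (u v : 'cV[C]_n) : rdot u v = rdot v u.
Proof. by rewrite !rdotE; apply: eq_bigr => i _; congr (_ + _); rewrite mulrC. Qed.

Lemma rdotDr n (u v w : 'cV[C]_n) : rdot u (v + w) = rdot u v + rdot u w.
Proof. by rewrite /rdot mulmxDr mxE cReD. Qed.

Lemma rdotDl n (u v w : 'cV[C]_n) : rdot (u + v) w = rdot u w + rdot v w.
Proof. by rewrite rdotC rdotDr !(rdotC w). Qed.

Lemma rdotZr n (u v : 'cV[C]_n) x : rdot u (cplx x *: v) = x * rdot u v.
Proof. by rewrite /rdot -scalemxAr mxE cReM /= mul0r subr0. Qed.

Lemma rdotZl n (u v : 'cV[C]_n) x : rdot (cplx x *: u) v = x * rdot u v.
Proof. by rewrite rdotC rdotZr rdotC. Qed.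

Lemma rdotNr n (u v : 'cV[C]_n) : rdot u (- v) = - rdot u v.
Proof. by rewrite /rdot mulmxN mxE cReN. Qed.

Lemma rdotMr n (A : 'M[C]_n) (u v : 'cV[C]_n) : rdot u (A *m v) = rdot (adjmx A *m u) v.
Proof. by rewrite /rdot adjmxM adjmxK mulmxA. Qed.

Lemma rdotMl n (A : 'M[C]_n) (u v : 'cV[C]_n) : rdot (A *m u) v = rdot u (adjmx A *m v).
Proof. by rewrite rdotMr adjmxK. Qed.

Lemma vnorm_ge0 n (v : 'cV[C]_n) : 0 <= vnorm v.
Proof. exact: sqrtr_ge0. Qed.
Hint Extern 0 (is_true (0 <= vnorm _)) => exact: vnorm_ge0 : core.

Lemma rdot_ge0 n (v : 'cV[C]_n) : 0 <= rdot v v.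
Proof. by rewrite rdotE; apply: sumr_ge0 => i _; rewrite -!expr2 addr_ge0 ?sqr_ge0. Qed.

Lemma vnormE n (v : 'cV[C]_n) : vnorm v = Num.sqrt (rdot v v).
Proof. by rewrite rdotE. Qed.

Lemma sqr_vnorm n (v : 'cV[C]_n) : vnorm v ^+ 2 = rdot v v.
Proof. by rewrite vnormE sqr_sqrtr// rdot_ge0. Qed.

Lemma vnorm_eq0 n (v : 'cV[C]_n) : vnorm v = 0 -> v = 0.
Proof.
move=> v0; have := sqr_vnorm v; rewrite v0 expr0n /= => /esym/eqP.
rewrite rdotE psumr_eq0 => [/allP h|i _]; last by rewrite -!expr2 addr_ge0 ?sqr_ge0.
apply/colP => i; rewrite mxE.
have := h i (mem_index_enum _); rewrite /= -!expr2 paddr_eq0 ?sqr_ge0 // !sqrf_eq0.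
by case: (v i 0) => a b /= /andP[/eqP -> /eqP ->].
Qed.

Lemma vnorm0 n : vnorm (0 : 'cV[C]_n) = 0.
Proof. by rewrite vnormE /rdot mulmx0 mxE sqrtr0. Qed.

(** Cauchy-Schwarz: with a = |u| and b = |v|, the squared norms of b u + a v and b u - a v are 2 a b
    (a b + <u, v>) and 2 a b (a b - <u, v>), both nonnegative. *)
Lemma rdot_le n (u v : 'cV[C]_n) : `|rdot u v| <= vnorm u * vnorm v.
Proof.
have [u0|u0] := eqVneq (vnorm u) 0.
  by rewrite (vnorm_eq0 u0) rdotC /rdot mulmx0 mxE /= normr0 vnorm0 mul0r.
have [v0|v0] := eqVneq (vnorm v) 0.
  by rewrite (vnorm_eq0 v0) /rdot mulmx0 mxE /= normr0 mulr_ge0.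
set a := vnorm u in u0 *; set b := vnorm v in v0 *.
have ab : 0 < a * b by rewrite mulr_gt0// lt0r ?u0 ?v0 /= vnorm_ge0.
have h1 := rdot_ge0 (cplx b *: u + cplx a *: v).
have h2 := rdot_ge0 (cplx b *: u - cplx a *: v).
move: h1 h2; rewrite !(rdotDl, rdotDr) -scaleNr.
have -> : - cplx a = cplx (- a) by rewrite /cplx -[LHS]/(Complex _ _) oppr0.
rewrite !(rdotZl, rdotZr) -!sqr_vnorm -/a -/b (rdotC v u) => h1 h2.
rewrite ler_norml; apply/andP; split; rewrite -(ler_pM2l ab); nra.
Qed.

Lemma vnormD n (u v : 'cV[C]_n) : vnorm (u + v) <= vnorm u + vnorm v.
Proof.
rewrite -(@ler_pXn2r _ 2) ?nnegrE ?addr_ge0//.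
rewrite sqr_vnorm !(rdotDl, rdotDr) -!sqr_vnorm (rdotC v u) sqrrD.
have := rdot_le u v; rewrite ler_norml => /andP[_ h]; lra.
Qed.

Lemma cabs_ge0 (z : C) : 0 <= cabs z. Proof. exact: sqrtr_ge0. Qed.

Lemma vnormZ n c (v : 'cV[C]_n) : vnorm (c *: v) = cabs c * vnorm v.
Proof.
rewrite /vnorm /cabs -sqrtrM ?addr_ge0 ?sqr_ge0// mulr_sumr; congr Num.sqrt.
by apply: eq_bigr => i _; rewrite !mxE cReM cImM; ring.
Qed.

Lemma cabs_cplx x : cabs (cplx x) = `|x|.
Proof. by rewrite /cabs /= expr0n addr0 sqrtr_sqr. Qed.

Lemma vnormN n (v : 'cV[C]_n) : vnorm (- v) = vnorm v.
Proof.
by rewrite !vnormE rdotNr rdotC rdotNr opprK.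
Qed.

Lemma vnormB n (u v : 'cV[C]_n) : vnorm (u - v) <= vnorm u + vnorm v.
Proof. by rewrite (le_trans (vnormD _ _))// vnormN. Qed.

Lemma vnorm_sum n (I : finType) (f : I -> 'cV[C]_n) :
  vnorm (\sum_i f i) <= \sum_i vnorm (f i).
Proof.
elim/big_ind2 : _ => [|u x v y ux vy|//]; first by rewrite vnorm0.
exact: le_trans (vnormD _ _) (lerD ux vy).
Qed.

Lemma cabs_le_vnorm n (v : 'cV[C]_n) j : cabs (v j 0) <= vnorm v.
Proof.
rewrite /cabs /vnorm ler_sqrt; last by apply: sumr_ge0 => i _; rewrite addr_ge0 ?sqr_ge0.
rewrite (bigD1 j)//= lerDl; apply: sumr_ge0 => i _.
by rewrite addr_ge0 ?sqr_ge0.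
Qed.

(** An upper bound in place of the supremum [opnorm]: error terms can be added to [c] without
    returning to the supremum. *)
Definition opbound m n (A : 'M[C]_(m, n)) (c : R) :=
  forall v : 'cV_n, vnorm (A *m v) <= c * vnorm v.

(** The sum of the column norms is a crude bound; its role is to show that the supremum defining
    [opnorm] is taken over a bounded set. *)
Lemma opbound_ex n (A : 'M[C]_n) : exists2 c, 0 <= c & opbound A c.
Proof.
exists (\sum_j vnorm (col j A)) => [|v]; first exact: sumr_ge0.
have -> : A *m v = \sum_j v j 0 *: col j A.
  apply/colP => i; rewrite !mxE summxE; apply: eq_bigr => j _.
  by rewrite !mxE mulrC.
rewrite (le_trans (vnorm_sum _))// mulr_suml ler_sum// => j _.
by rewrite vnormZ mulrC ler_wpM2l// cabs_le_vnorm.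
Qed.

Lemma opnorm_has_ubound n (A : 'M[C]_n) :
  has_ubound [set vnorm (A *m v) | v in [set v : 'cV[C]_n | vnorm v <= 1]].
Proof.
have [c c0 hc] := opbound_ex A; exists c => _ [w /= w1 <-].
by rewrite (le_trans (hc w))// -[leRHS]mulr1 ler_wpM2l.
Qed.

Lemma opnorm_bound n (A : 'M[C]_n) : opbound A (opnorm A).
Proof.
move=> v; have hub := opnorm_has_ubound A.
have [v0|v0] := eqVneq (vnorm v) 0.
  by rewrite (vnorm_eq0 v0) mulmx0 !vnorm0 mulr0.
have vp : 0 < vnorm v by rewrite lt0r v0 vnorm_ge0.
rewrite -ler_pdivrMr//.
apply: (ub_le_sup hub); exists (cplx (vnorm v)^-1 *: v) => /=.
  by rewrite vnormZ cabs_cplx ger0_norm ?invr_ge0// mulVf.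
by rewrite -scalemxAr vnormZ cabs_cplx ger0_norm ?invr_ge0// mulrC.
Qed.

Lemma opnorm_ge0 n (A : 'M[C]_n) : 0 <= opnorm A.
Proof.
apply: (ub_le_sup (opnorm_has_ubound A)); exists 0 => /=; first by rewrite vnorm0.
by rewrite mulmx0 vnorm0.
Qed.

End EuclideanNorm.

#[global] Hint Extern 0 (is_true (0 <= vnorm _)) => exact: vnorm_ge0 : core.

(** * Mean value estimates and the unit complex numbers exp (i u) *)

Section Expi.
Context {R : realType}.
Local Notation C := R[i].

Lemma MVT_ex (f df : R -> R) (x y : R) : (forall z : R, is_derive z 1 f (df z)) ->
  exists2 z, `|z - x| <= `|y - x| & f y - f x = df z * (y - x).
Proof.
move=> fdf.
have cf a b : {within `[a, b], continuous f}.
  apply: continuous_subspaceT => z.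
  by apply/differentiable_continuous/derivable1_diffP; have [] := fdf z.
have [xy|/ltW yx] := leP x y.
  have [z zi ->] := MVT_segment xy (fun z _ => fdf z) (cf _ _).
  exists z => //; move: zi; rewrite in_itv /= => /andP[xz zy].
  by rewrite !ger0_norm ?subr_ge0 ?lerD2r.
have [z zi E] := MVT_segment yx (fun z _ => fdf z) (cf _ _).
exists z; last by rewrite -opprB E -mulrN opprB.
move: zi; rewrite in_itv /= => /andP[xz zy].
by rewrite !(distrC _ x) !ger0_norm ?subr_ge0 ?lerD2l ?lerN2.
Qed.

Lemma derive1_lipschitz (f : R -> R) K : (forall x : R, derivable f x 1) ->
  (forall x, `|derive1 f x| <= K) -> forall x y, `|f x - f y| <= K * `|x - y|.
Proof.
move=> df fK x y.
have [|z _ ->] := @MVT_ex f (derive1 f) y x.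
  by move=> z; rewrite derive1E; exact/derivableP.
by rewrite normrM ler_wpM2r.
Qed.

Definition expi (u : R) : C := Complex (cos u) (sin u).

Lemma expiD u v : expi (u + v) = expi u * expi v.
Proof.
apply/eqP; rewrite eq_complex cReM cImM /= cosD sinD eqxx /=; apply/eqP; ring.
Qed.

Lemma expi0 : expi 0 = 1.
Proof. by rewrite /expi cos0 sin0. Qed.

Lemma cconj_expi u : cconj (expi u) = expi (- u).
Proof. by rewrite /expi cosN sinN. Qed.

(** The mean value theorem bounds both |cos u - 1| and |sin u - u| by u^2. The constant 2 is
    generous: only the quadratic order matters, since the remainder disappears in the limit of small
    time steps. *)
Lemma cabs_expi_taylor1 (u : R) : cabs (expi u - 1 - Complex 0 u) <= 2 * u ^+ 2.
Proof.
have hs (z : R) : `|sin z| <= `|z|.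
  have [w _] := @MVT_ex sin cos 0 z (fun z : R => is_derive_sin z).
  rewrite sin0 !subr0 => ->; rewrite normrM -[leRHS]mul1r ler_wpM2r//.
  by rewrite ler_norml cos_geN1 cos_le1.
have hc (z : R) : `|cos z - 1| <= z ^+ 2.
  have [w] := @MVT_ex cos (fun z => - sin z) 0 z (fun z : R => is_derive_cos z).
  rewrite cos0 !subr0 => wz ->; rewrite normrM normrN -real_normK ?num_real// expr2.
  by rewrite ler_wpM2r// (le_trans (hs w)).
have hc1 (z : R) : `|cos z - 1| <= `|z|.
  have [w] := @MVT_ex cos (fun z => - sin z) 0 z (fun z : R => is_derive_cos z).
  rewrite cos0 !subr0 => wz ->; rewrite normrM normrN -[leRHS]mul1r ler_wpM2r//.
  by rewrite ler_norml sin_geN1 sin_le1.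
have hsu : `|sin u - u| <= u ^+ 2.
  have [w] := @MVT_ex (fun z => sin z - z) (fun z => cos z - 1) 0 u
    (fun z : R => is_deriveB (is_derive_sin z) (is_derive_id z 1)).
  rewrite sin0 !subr0 => wz ->; rewrite normrM -(@real_normK _ u) ?num_real// expr2.
  by rewrite ler_wpM2r// (le_trans (hc1 w)).
have u2 := sqr_ge0 u.
rewrite /cabs /= !subr0 -(@ler_pXn2r _ 2) ?nnegrE ?sqrtr_ge0 ?(pmulr_rge0 _ (ltr0Sn _ 1))//.
rewrite sqr_sqrtr ?addr_ge0 ?sqr_ge0//.
have := hc u; have := hsu; rewrite !ler_norml => /andP[h1 h2] /andP[h3 h4].
nra.
Qed.

End Expi.

(** * Exponentials of Hermitian matrices *)

Ltac complex_ring := apply/eqP; rewrite eq_complex ?(cReM, cImM) /=;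
  apply/andP; split; apply/eqP; ring.

Section Spectral.
Context {R : realType}.
Local Notation C := R[i].

Definition rdiag n (d : 'I_n -> R) : 'M[C]_n := diag_mx (\row_j cplx (d j)).
Definition ediag n (d : 'I_n -> R) : 'M[C]_n := diag_mx (\row_j expi (d j)).

Definition unitary n (P : 'M[C]_n) := P *m adjmx P = 1%:M /\ adjmx P *m P = 1%:M.

(** The spectral theorem for normal matrices; hermiticity makes the eigenvalues real, so they are
    recorded as a real function [d]. *)
Lemma hermitian_diag n (A : 'M[C]_n) : is_hermitian A ->
  exists P d, unitary P /\ A = adjmx P *m rdiag d *m P.
Proof.
move=> hA.
have hA' : A \is hermsymmx.
  by rewrite is_hermitianmxE expr0 scale1r -adjmxE hA.
have /orthomx_spectralP hd := hermitian_normalmx hA'.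
have hr := hermitian_spectral_diag_real hA'.
have hu := spectral_unitarymx A.
have aE : adjmx (spectralmx A) = invmx (spectralmx A).
  by rewrite invmx_unitary// adjmxE.
exists (spectralmx A), (fun j => complex.Re (spectral_diag A 0 j)); split.
  by split; rewrite aE ?mulmxV ?mulVmx// spectral_unit.
rewrite aE [LHS]hd; congr (_ *m diag_mx _ *m _).
apply/rowP => j; rewrite !mxE.
by have /mxOverP /(_ 0 j) /RRe_real <- := hr.
Qed.

Lemma vnorm_unitary n (P : 'M[C]_n) v : adjmx P *m P = 1%:M -> vnorm (P *m v) = vnorm v.
Proof. by move=> hP; rewrite !vnormE rdotMr mulmxA hP mul1mx. Qed.

(** Convergence by real and imaginary parts, which is how [expm] takes its limits. *)
Definition ccvg (u : nat -> C) (l : C) :=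
  (fun n => complex.Re (u n)) @ \oo --> complex.Re l /\
  (fun n => complex.Im (u n)) @ \oo --> complex.Im l.

Lemma ccvg_cst l : ccvg (fun=> l) l.
Proof. by split; exact: cvg_cst. Qed.

Lemma ccvgD u v k l : ccvg u k -> ccvg v l -> ccvg (fun n => u n + v n) (k + l).
Proof.
move=> [u1 u2] [v1 v2]; split.
  rewrite cReD (_ : (fun n => _) = (fun n => complex.Re (u n) + complex.Re (v n))).
    exact: cvgD.
  by apply/funext => n; rewrite cReD.
rewrite cImD (_ : (fun n => _) = (fun n => complex.Im (u n) + complex.Im (v n))).
  exact: cvgD.
by apply/funext => n; rewrite cImD.
Qed.

Lemma ccvgM u v k l : ccvg u k -> ccvg v l -> ccvg (fun n => u n * v n) (k * l).
Proof.
move=> [u1 u2] [v1 v2]; split.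
  rewrite cReM (_ : (fun n => _) = (fun n => complex.Re (u n) * complex.Re (v n)
     - complex.Im (u n) * complex.Im (v n))).
    by apply: cvgB; exact: cvgM.
  by apply/funext => n; rewrite cReM.
rewrite cImM (_ : (fun n => _) = (fun n => complex.Re (u n) * complex.Im (v n)
     + complex.Im (u n) * complex.Re (v n))).
  by apply: cvgD; exact: cvgM.
by apply/funext => n; rewrite cImM.
Qed.

Lemma ccvg_sum (I : Type) (r : seq I) (u : I -> nat -> C) (l : I -> C) :
  (forall i, ccvg (u i) (l i)) -> ccvg (fun n => \sum_(i <- r) u i n) (\sum_(i <- r) l i).
Proof.
move=> h; elim: r => [|i r ih].
  rewrite big_nil (_ : (fun n => _) = fun=> 0); first exact: ccvg_cst.
  by apply/funext => n; rewrite big_nil.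
rewrite big_cons (_ : (fun n => _) = fun n => u i n + \sum_(i <- r) u i n).
  exact: ccvgD.
by apply/funext => n; rewrite big_cons.
Qed.

(** Since i^(2m) = (-1)^m, the parity of [k] decides which of the two parts is nonzero, matching the
    coefficients of the power series of cosine and sine. *)
Lemma expi_coeff u k : ((k`!)%:R^-1 : C) * (Complex 0 u) ^+ k =
  Complex (cos_coeff u k) (sin_coeff u k).
Proof.
have fE : ((k`!)%:R^-1 : C) = cplx (k`!%:R^-1).
  by rewrite -[in LHS](rmorph_nat (real_complex R)) -fmorphV.
have pE : (Complex 0 u) ^+ k = cplx (u ^+ k) * (Complex 0 1) ^+ k.
  have -> : Complex 0 u = cplx u * Complex 0 1.
    by complex_ring.
  by rewrite exprMn /cplx -[Complex u 0]/(real_complex R u) -rmorphXn.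
have iE m : (Complex 0 1 : C) ^+ m.*2 = cplx ((-1) ^+ m).
  rewrite -muln2 mulnC exprM sqr_i; elim: m => [|m ih]; first by rewrite !expr0.
  by rewrite !exprS ih; complex_ring.
rewrite fE pE /cos_coeff /sin_coeff /=.
rewrite -{3}(odd_double_half k); case: (boolP (odd k)) => ko /=.
  rewrite exprS iE; apply/eqP; rewrite eq_complex !(cReM, cImM) /=.
  have -> : (k.-1)./2 = k./2 by rewrite -{1}(odd_double_half k) ko /= doubleK.
  rewrite -!exprnP; apply/andP; split; apply/eqP; ring.
rewrite add0n iE; apply/eqP; rewrite eq_complex !(cReM, cImM) /=.
rewrite -!exprnP; apply/andP; split; apply/eqP; ring.
Qed.

Lemma ccvg_expi u : ccvg (fun K => \sum_(k < K) ((k`!)%:R^-1 : C) * (Complex 0 u) ^+ k) (expi u).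
Proof.
split.
  rewrite (_ : (fun n => _) = series (cos_coeff u)).
    by rewrite /expi /= cos.unlock; exact: is_cvg_series_cos_coeff.
  apply/funext => n; rewrite cRe_sum /series /= big_mkord; apply: eq_bigr => i _.
  by rewrite expi_coeff.
rewrite (_ : (fun n => _) = series (sin_coeff u)).
  by rewrite /expi /= sin.unlock; exact: is_cvg_series_sin_coeff.
apply/funext => n; rewrite cIm_sum /series /= big_mkord; apply: eq_bigr => i _.
by rewrite expi_coeff.
Qed.

Lemma mxpow_diag n (P : 'M[C]_n) (d : 'rV[C]_n) k : unitary P ->
  mxpow (adjmx P *m diag_mx d *m P) k = adjmx P *m diag_mx (\row_j (d 0 j) ^+ k) *m P.
Proof.
move=> [h1 h2]; elim: k => [|k ih].
  rewrite /mxpow /= (_ : \row_j _ = const_mx 1) ?diag_const_mx ?mulmx1 ?h2//.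
  by apply/rowP => j; rewrite !mxE expr0.
rewrite /mxpow iterS -/(mxpow _ _) ih !mulmxA -[_ *m P *m adjmx P]mulmxA h1 mulmx1.
rewrite -[adjmx P *m _ *m _]mulmxA mulmx_diag; congr (_ *m diag_mx _ *m _).
by apply/rowP => j; rewrite !mxE exprS.
Qed.

(** In an eigenbasis, each entry of a partial sum is a fixed finite combination of the scalar
    partial sums of exp (i s d_l), once the sums over powers and over eigenvalues are exchanged. *)
Lemma expm_cvg_diag n (P : 'M[C]_n) (d : 'I_n -> R) s i j : unitary P ->
  ccvg (fun K => expm_partial (Complex 0 s *: (adjmx P *m rdiag d *m P)) K i j)
       ((adjmx P *m ediag (fun j => s * d j) *m P) i j).
Proof.
move=> hP.
have -> : Complex 0 s *: (adjmx P *m rdiag d *m P) =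
    adjmx P *m diag_mx (\row_j Complex 0 (s * d j)) *m P.
  rewrite scalemxAl scalemxAr; congr (_ *m _ *m _).
  rewrite /rdiag -linearZ /=; congr diag_mx; apply/rowP => k; rewrite !mxE.
  by complex_ring.
rewrite [X in ccvg _ X]mxE.
rewrite (_ : (fun K => _) = fun K => \sum_l (adjmx P i l * \sum_(k < K) ((k`!)%:R^-1 : C) * (Complex 0 (s * d l)) ^+ k) * P l j).
  apply: ccvg_sum => l; apply: ccvgM; last exact: ccvg_cst.
  by rewrite mul_mx_diag [X in ccvg _ X]mxE [X in ccvg _ (_ * X)]mxE; apply: ccvgM; [exact: ccvg_cst|exact: ccvg_expi].
apply/funext => K; rewrite /expm_partial summxE.
under eq_bigr do rewrite mxpow_diag// mxE mul_mx_diag mxE mulr_sumr.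
rewrite exchange_big /=; apply: eq_bigr => l _.
rewrite mulr_sumr mulr_suml; apply: eq_bigr => k _; rewrite !mxE; ring.
Qed.

Lemma expm_diag n (P : 'M[C]_n) (d : 'I_n -> R) s : unitary P ->
  expm (Complex 0 s *: (adjmx P *m rdiag d *m P)) =
  adjmx P *m ediag (fun j => s * d j) *m P.
Proof.
move=> hP; apply/matrixP => i j; rewrite [LHS]mxE.
have [h1 h2] := expm_cvg_diag d s i j hP.
rewrite (cvg_lim _ h1)// (cvg_lim _ h2)//.
by case: (_ i j).
Qed.

Lemma expm_cvg n (A : 'M[C]_n) s i j : is_hermitian A ->
  ccvg (fun K => expm_partial (Complex 0 s *: A) K i j) (expm (Complex 0 s *: A) i j).
Proof.
move=> /hermitian_diag [P [d [hP ->]]]; rewrite expm_diag//; exact: expm_cvg_diag.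
Qed.

Lemma ediagD n (d e : 'I_n -> R) : ediag (fun j => d j + e j) = ediag d *m ediag e.
Proof.
by rewrite mulmx_diag; congr diag_mx; apply/rowP => j; rewrite !mxE expiD.
Qed.

Lemma adjmx_ediag n (d : 'I_n -> R) : adjmx (ediag d) = ediag (fun j => - d j).
Proof.
rewrite adjmxE tr_diag_mx map_diag_mx; congr diag_mx; apply/rowP => j.
by rewrite !mxE -cconj_expi cconjE.
Qed.

End Spectral.

(* Locked: otherwise unification tries to compare the limits inside [expm]. *)
HB.lock Definition propag {R : realType} {n : nat} (A : 'M[R[i]]_n) (s : R) :=
  expm (Complex 0 s *: A).

(** * Unitary propagators and their dependence on the Hamiltonian *)

Section Propagator.
Context {R : realType}.
Local Notation C := R[i].

Lemma heisenbergE n (H O : 'M[C]_n) t : heisenberg H O t = propag H t *m O *m propag H (- t).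
Proof. by rewrite !propag.unlock. Qed.

Lemma propagD n (A : 'M[C]_n) s t : is_hermitian A ->
  propag A (s + t) = propag A s *m propag A t.
Proof.
move=> /hermitian_diag [P [d [hP ->]]]; rewrite !propag.unlock !expm_diag//.
have -> : ediag (fun j => (s + t) * d j) = ediag (fun j => s * d j) *m ediag (fun j => t * d j).
  by rewrite -ediagD; congr ediag; apply/funext => j; rewrite mulrDl.
by rewrite !mulmxA -[_ *m P *m adjmx P]mulmxA hP.1 mulmx1.
Qed.

Lemma propag0 n (A : 'M[C]_n) : is_hermitian A -> propag A 0 = 1%:M.
Proof.
move=> /hermitian_diag [P [d [hP ->]]]; rewrite !propag.unlock !expm_diag//.
rewrite (_ : ediag _ = 1%:M) ?mulmx1 ?hP.2//.
rewrite /ediag -diag_const_mx; congr diag_mx; apply/rowP => j.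
by rewrite !mxE mul0r expi0.
Qed.

Lemma adjmx_propag n (A : 'M[C]_n) s : is_hermitian A ->
  adjmx (propag A s) = propag A (- s).
Proof.
move=> /hermitian_diag [P [d [hP ->]]]; rewrite !propag.unlock !expm_diag//.
rewrite !adjmxM adjmxK adjmx_ediag !mulmxA; congr (_ *m ediag _ *m _).
by apply/funext => j; rewrite mulNr.
Qed.

Lemma vnorm_propag n (A : 'M[C]_n) s v : is_hermitian A -> vnorm (propag A s *m v) = vnorm v.
Proof.
move=> hA; apply: vnorm_unitary.
by rewrite adjmx_propag// -propagD// addNr propag0.
Qed.

Lemma opbound_diag n (d : 'rV[C]_n) c : (forall j, cabs (d 0 j) <= c) -> opbound (diag_mx d) c.
Proof.
(* [0 <= c] can only be read off from an index, so dimension zero is treated apart. *)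
move=> dc v; have [n0|[j0]] : n = 0%N \/ exists j : 'I_n, True.
- by case: (n) => [|m]; [left|right; exists ord0].
- move: d dc v; rewrite n0 => d _ v.
  have -> : v = 0 by apply/colP => -[].
  by rewrite mulmx0 vnorm0 mulr0.
move=> _; have c0 : 0 <= c by exact: le_trans (cabs_ge0 _) (dc j0).
rewrite -(@ler_pXn2r _ 2) ?nnegrE ?mulr_ge0// exprMn !sqr_vnorm !rdotE mulr_sumr.
apply: ler_sum => j _; rewrite mul_diag_mx !mxE !cReM !cImM.
have : cabs (d 0 j) ^+ 2 <= c ^+ 2 by rewrite ler_pXn2r ?nnegrE ?cabs_ge0.
rewrite /cabs sqr_sqrtr ?addr_ge0 ?sqr_ge0// => h.
set x := complex.Re (v j 0); set y := complex.Im (v j 0).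
have h2 : 0 <= x ^+ 2 + y ^+ 2 by rewrite addr_ge0 ?sqr_ge0.
have := ler_wpM2r h2 h; nra.
Qed.

(** Conjugation by a unitary reduces the remainder to its diagonal entries. The constant depends on
    the spectrum of [A], which is harmless because it is multiplied by s^2. *)
Lemma propag_taylor1 n (A : 'M[C]_n) : is_hermitian A ->
  exists2 c, 0 <= c & forall s, opbound (propag A s - 1%:M - Complex 0 s *: A) (c * s ^+ 2).
Proof.
move=> /hermitian_diag [P [d [hP ->]]].
exists (\sum_j 2 * d j ^+ 2) => [|s v].
  by apply: sumr_ge0 => j _; rewrite mulr_ge0 ?sqr_ge0.
rewrite !propag.unlock expm_diag// -hP.2 -{2}[adjmx P]mulmx1.
rewrite scalemxAl scalemxAr -!mulmxBl -!mulmxBr -diag_const_mx.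
rewrite /rdiag /ediag -linearZ -!linearB /= -!mulmxA.
rewrite vnorm_unitary ?adjmxK; last exact: hP.1.
rewrite -(vnorm_unitary v hP.2); apply: opbound_diag => j.
rewrite !mxE.
have -> : Complex 0 s * cplx (d j) = Complex 0 (s * d j) :> C by complex_ring.
rewrite (le_trans (cabs_expi_taylor1 _))//.
rewrite mulr_suml (bigD1 j)//= exprMn mulrCA (mulrC (s ^+ 2)) mulrA lerDl.
by apply: sumr_ge0 => i _; exact: mulr_ge0 (mulr_ge0 (ler0n _ 2) (sqr_ge0 _)) (sqr_ge0 _).
Qed.

(** The first-order terms differ by i s (A - B), which gives |s| h with the sharp constant; the two
    Taylor remainders go into [c]. *)
Lemma opbound_propagB_small n (A B : 'M[C]_n) h : is_hermitian A -> is_hermitian B ->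
  opbound (A - B) h -> exists2 c, 0 <= c &
  forall s, opbound (propag A s - propag B s) (`|s| * h + c * s ^+ 2).
Proof.
move=> hA hB hh; have [a a0 ha] := propag_taylor1 hA; have [b b0 hb] := propag_taylor1 hB.
exists (a + b) => [|s v]; first exact: addr_ge0.
have -> : propag A s - propag B s = (propag A s - 1%:M - Complex 0 s *: A)
   - (propag B s - 1%:M - Complex 0 s *: B) + Complex 0 s *: (A - B).
  by move: (propag A s) (propag B s) => X Y; apply/matrixP => i j; rewrite !mxE; ring.
rewrite mulmxDl mulmxBl -scalemxAl.
rewrite (le_trans (vnormD _ _))// vnormZ (_ : cabs (Complex 0 s) = `|s|); last first.
  by rewrite /cabs /= expr0n add0r sqrtr_sqr.
rewrite [leRHS](_ : _ =
    a * s ^+ 2 * vnorm v + b * s ^+ 2 * vnorm v + `|s| * (h * vnorm v)); last by ring.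
apply: lerD; last by rewrite ler_wpM2l.
exact: le_trans (vnormB _ _) (lerD (ha s v) (hb s v)).
Qed.


Lemma mulmxB_telescope n (X X' Y Y' : 'M[C]_n) :
  X *m X' - Y *m Y' = X *m (X' - Y') + (X - Y) *m Y'.
Proof. by rewrite mulmxBr mulmxBl addrA subrK. Qed.

(** One step is exchanged at a time. The remaining factors are unitary and preserve norms, so the
    error grows linearly in [k]. *)
Lemma opbound_propagB_mul n (A B : 'M[C]_n) s c k : is_hermitian A -> is_hermitian B ->
  opbound (propag A s - propag B s) c ->
  opbound (propag A (s *+ k) - propag B (s *+ k)) (c *+ k).
Proof.
move=> hA hB hc; elim: k => [|k ih] v.
  by rewrite !mulr0n !propag0// subrr mul0mx vnorm0 mul0r.
rewrite !mulrS !propagD//.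
rewrite mulmxB_telescope mulmxDl (le_trans (vnormD _ _))// -!mulmxA vnorm_propag//.
have := hc (propag B (s *+ k) *m v); rewrite vnorm_propag// => h1.
rewrite mulrDl [leRHS]addrC; exact: lerD (ih v) h1.
Qed.

(* [exp (i t A) = (exp (i t A / k)) ^ k], and the [k] factors contribute
   [(t / k) h + O (1 / k ^ 2)] each. *)
Lemma opbound_propagB n (A B : 'M[C]_n) s h : is_hermitian A -> is_hermitian B ->
  opbound (A - B) h -> opbound (propag A s - propag B s) (`|s| * h).
Proof.
move=> hA hB hh v; have [c c0 hc] := opbound_propagB_small hA hB hh.
apply/ler_addgt0Pr => e e0.
set K := c * s ^+ 2 * vnorm v.
have K0 : 0 <= K by exact: mulr_ge0 (mulr_ge0 c0 (sqr_ge0 _)) (vnorm_ge0 _).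
(* [K / k] is the total remainder after [k] steps; this [k] exceeds [K / e], so the remainder is at
   most [e], and the successor keeps [k] positive. *)
pose k := (Num.truncn (K / e)).+1.
have kp : 0 < k%:R :> R by rewrite ltr0n.
have kK : K / k%:R <= e.
  rewrite ler_pdivrMr// mulrC -ler_pdivrMr// ltW// /k.
  exact: Num.Theory.truncnS_gt.
have sk : (s / k%:R) *+ k = s by rewrite -mulr_natr divfK// gt_eqF.
have := opbound_propagB_mul k hA hB (hc (s / k%:R)) v; rewrite sk => hv.
apply: (le_trans hv); rewrite -[_ *+ k]mulr_natr.
rewrite normrM normfV normr_nat exprMn exprVn.
have -> : (`|s| / k%:R * h + c * (s ^+ 2 / k%:R ^+ 2)) * k%:R * vnorm v =
   `|s| * h * vnorm v + K / k%:R.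
  by rewrite /K; field; rewrite gt_eqF.
by rewrite lerD2l.
Qed.

End Propagator.

(** * Expectation values in the Heisenberg picture *)

Section Observable.
Context {R : realType}.
Local Notation C := R[i].


Lemma rdot_delta n j (w : 'cV[C]_n) : rdot (delta_mx j 0) w = complex.Re (w j 0).
Proof.
rewrite /rdot (_ : adjmx _ = delta_mx 0 j) -?rowE ?mxE//.
by apply/rowP => i; rewrite !mxE cconjE conjC_nat andbC.
Qed.

Lemma mul_delta_col m n (A : 'M[C]_(m, n)) i j : (A *m delta_mx j (0 : 'I_1)) i 0 = A i j.
Proof. by rewrite -colE mxE. Qed.

(** A density matrix is a mixture of pure states: [v j] are orthonormal eigenvectors and [p j] the
    eigenvalues, nonnegative by positivity and summing to 1 by the trace condition. Estimates on
    unit vectors then extend by convexity. *)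
Lemma density_trace n (rho : 'M[C]_n) : density_matrix rho ->
  exists (p : 'I_n -> R) (v : 'I_n -> 'cV[C]_n),
  [/\ forall j, 0 <= p j, \sum_j p j = 1, forall j, vnorm (v j) = 1 &
      forall Y, complex.Re (\tr (rho *m Y)) = \sum_j p j * rdot (v j) (Y *m v j)].
Proof.
move=> [hr hpsd htr]; have [P [d [hP rE]]] := hermitian_diag hr.
pose v j : 'cV[C]_n := adjmx P *m delta_mx j 0.
have trE Y : complex.Re (\tr (rho *m Y)) = \sum_j d j * rdot (v j) (Y *m v j).
  rewrite rE -!mulmxA mxtrace_mulC -!mulmxA /mxtrace cRe_sum; apply: eq_bigr => j _.
  rewrite mul_diag_mx mxE mxE cReM /= mul0r subr0; congr (_ * _).
  by rewrite /v mulmxA rdotMl adjmxK rdot_delta 2!mulmxA mul_delta_col -!mulmxA.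
exists d, v; split => // [j||j].
- have [_] := hpsd (v j); rewrite -mulmxA -/(rdot _ _) {1}/v rdotMl adjmxK.
  rewrite rdot_delta rE /v !mulmxA hP.1 mul1mx -[_ *m P *m adjmx P]mulmxA hP.1 mulmx1.
  by rewrite mul_delta_col !mxE eqxx.
- have := congr1 (@complex.Re R) htr; rewrite -[rho]mulmx1 trE /= => <-.
  apply: eq_bigr => j _; rewrite mul1mx /v rdotMl adjmxK mulmxA hP.1 mul1mx.
  by rewrite rdot_delta mxE !eqxx /= mulr1.
- rewrite vnormE /v rdotMl adjmxK mulmxA hP.1 mul1mx.
  by rewrite rdot_delta mxE !eqxx /= sqrtr1.
Qed.

Lemma rdot_opnorm n (A : 'M[C]_n) u v : `|rdot u (A *m v)| <= opnorm A * (vnorm u * vnorm v).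
Proof.
rewrite (le_trans (rdot_le _ _))// mulrCA ler_wpM2l//; exact: opnorm_bound.
Qed.

(** Inserting <v, A u> splits the difference into two terms, each linear in u - v; this is the
    origin of the factor 2 in the final bound. *)
Lemma rdot_quadratic_lipschitz n (A : 'M[C]_n) u v : vnorm u = 1 -> vnorm v = 1 ->
  `|rdot u (A *m u) - rdot v (A *m v)| <= 2 * opnorm A * vnorm (u - v).
Proof.
move=> u1 v1.
have -> : rdot u (A *m u) - rdot v (A *m v) = rdot (u - v) (A *m u) + rdot v (A *m (u - v)).
  by rewrite mulmxBr rdotDr rdotDl rdotNr (rdotC (- v)) rdotNr (rdotC v (A *m u)); ring.
rewrite (le_trans (ler_normD _ _))//.
have := rdot_opnorm A (u - v) u; have := rdot_opnorm A v (u - v).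
rewrite u1 v1; lra.
Qed.

Lemma is_hermitianD n (A B : 'M[C]_n) : is_hermitian A -> is_hermitian B -> is_hermitian (A + B).
Proof. by move=> hA hB; rewrite /is_hermitian adjmxD hA hB. Qed.

Lemma is_hermitianZ n x (A : 'M[C]_n) : is_hermitian A -> is_hermitian (cplx x *: A).
Proof. by move=> hA; rewrite /is_hermitian adjmxZ hA /cconj /= oppr0. Qed.

Lemma is_hermitian0 n : is_hermitian (0 : 'M[C]_n).
Proof. by apply/matrixP => i j; rewrite !mxE cconjE conjC0. Qed.

Lemma is_hermitian_sum n (I : finType) (f : I -> 'M[C]_n) :
  (forall i, is_hermitian (f i)) -> is_hermitian (\sum_i f i).
Proof.
move=> h; elim/big_ind : _ => [|A B hA hB|//]; first exact: is_hermitian0.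
exact: is_hermitianD.
Qed.

Lemma heisenberg_hermitian n (H O : 'M[C]_n) t : is_hermitian H -> is_hermitian O ->
  is_hermitian (heisenberg H O t).
Proof.
move=> hH hO; rewrite /is_hermitian heisenbergE 2!adjmxM hO.
by rewrite !adjmx_propag// opprK mulmxA.
Qed.

(** The conjugate of tr (A B) is the trace of its adjoint B A, which equals tr (A B) by
    cyclicity. *)
Lemma Im_trace_hermitian n (A B : 'M[C]_n) : is_hermitian A -> is_hermitian B ->
  complex.Im (\tr (A *m B)) = 0.
Proof.
move=> hA hB; have : cconj (\tr (A *m B)) = \tr (A *m B).
  rewrite -{2}hA -{2}hB -adjmxM mxtrace_mulC [in RHS]/mxtrace.
  rewrite cconjE rmorph_sum; apply: eq_bigr => i _; rewrite !mxE cconjE; congr Num.conj.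
by case: (\tr _) => x y [] /= h; lra.
Qed.

Lemma rdot_heisenberg n (H O : 'M[C]_n) t u : is_hermitian H ->
  rdot u (propag H t *m O *m propag H (- t) *m u) =
  rdot (propag H (- t) *m u) (O *m (propag H (- t) *m u)).
Proof. by move=> hH; rewrite -!mulmxA rdotMr adjmx_propag. Qed.

Lemma trace_heisenberg_bound n (rho H O : 'M[C]_n) t : density_matrix rho -> is_hermitian H ->
  `|complex.Re (\tr (rho *m heisenberg H O t))| <= opnorm O.
Proof.
move=> /density_trace [p [v [p0 p1 v1 trE]]] hH.
rewrite heisenbergE trE.
rewrite (le_trans (ler_norm_sum _ _ _))// -[leRHS]mul1r -[X in _ <= X * _]p1 mulr_suml ler_sum// => j _.
rewrite normrM ger0_norm// ler_wpM2l// rdot_heisenberg// (le_trans (rdot_opnorm _ _ _))//.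
by rewrite !vnorm_propag// v1 !mulr1.
Qed.

(** Moving the propagators onto the pure states leaves the same quadratic form of [O] at two evolved
    unit vectors, whose distance is at most |t| h. *)
Lemma trace_heisenberg_lipschitz n (rho A B O : 'M[C]_n) t h : density_matrix rho ->
  is_hermitian A -> is_hermitian B -> opbound (A - B) h ->
  `|complex.Re (\tr (rho *m heisenberg A O t)) - complex.Re (\tr (rho *m heisenberg B O t))|
  <= 2 * opnorm O * `|t| * h.
Proof.
move=> /density_trace [p [v [p0 p1 v1 trE]]] hA hB hh.
rewrite !heisenbergE !trE -sumrB.
rewrite (le_trans (ler_norm_sum _ _ _))// -[leRHS]mul1r -[X in _ <= X * _]p1 mulr_suml ler_sum// => j _.
rewrite -mulrBr normrM ger0_norm// ler_wpM2l// !rdot_heisenberg//.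
rewrite (le_trans (rdot_quadratic_lipschitz _ _ _)) ?vnorm_propag//.
rewrite -mulmxBl -!mulrA !ler_wpM2l ?opnorm_ge0//.
by have := opbound_propagB (- t) hA hB hh (v j); rewrite v1 mulr1 normrN.
Qed.

End Observable.

(** * Measurability of complex and matrix-valued maps *)

Section ComplexMeasurability.
Context d (S : measurableType d) {R : realType}.
Local Notation C := R[i].

Definition measurable_complex (f : S -> C) :=
  measurable_fun setT (fun x => complex.Re (f x)) /\
  measurable_fun setT (fun x => complex.Im (f x)).

Lemma measurable_complex_cst c : measurable_complex (fun=> c).
Proof. by split; exact: measurable_cst. Qed.

Lemma measurable_complexD f g : measurable_complex f -> measurable_complex g ->
  measurable_complex (fun x => f x + g x).
Proof.
move=> [f1 f2] [g1 g2]; split.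
  by under eq_fun do rewrite cReD; exact: measurable_funD.
by under eq_fun do rewrite cImD; exact: measurable_funD.
Qed.

Lemma measurable_complexM f g : measurable_complex f -> measurable_complex g ->
  measurable_complex (fun x => f x * g x).
Proof.
move=> [f1 f2] [g1 g2]; split.
  by under eq_fun do rewrite cReM; apply: measurable_funB; exact: measurable_funM.
by under eq_fun do rewrite cImM; apply: measurable_funD; exact: measurable_funM.
Qed.

Lemma measurable_complex_sum (I : Type) (r : seq I) (f : I -> S -> C) :
  (forall i, measurable_complex (f i)) ->
  measurable_complex (fun x => \sum_(i <- r) f i x).
Proof.
move=> mf; elim: r => [|i r ih].
  by under eq_fun do rewrite big_nil; exact: measurable_complex_cst.
by under eq_fun do rewrite big_cons; exact: measurable_complexD.
Qed.

Lemma measurable_complex_cvg (f : nat -> S -> C) g :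
  (forall n, measurable_complex (f n)) -> (forall x, ccvg (f ^~ x) (g x)) ->
  measurable_complex g.
Proof.
move=> mf fg; split.
  apply: (measurable_fun_cvg (h := fun n x => complex.Re (f n x))) => [n|x _].
    exact: (mf n).1.
  exact: (fg x).1.
apply: (measurable_fun_cvg (h := fun n x => complex.Im (f n x))) => [n|x _].
  exact: (mf n).2.
exact: (fg x).2.
Qed.

Definition measurable_mx m n (A : S -> 'M[C]_(m, n)) :=
  forall i j, measurable_complex (fun x => A x i j).

Lemma measurable_mx_cst m n (A : 'M[C]_(m, n)) : measurable_mx (fun=> A).
Proof. by move=> i j; exact: measurable_complex_cst. Qed.

Lemma measurable_mxD m n (A B : S -> 'M[C]_(m, n)) : measurable_mx A -> measurable_mx B ->
  measurable_mx (fun x => A x + B x).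
Proof.
by move=> mA mB i j; under eq_fun do rewrite mxE; exact: measurable_complexD.
Qed.

Lemma measurable_mxZ m n f (A : S -> 'M[C]_(m, n)) : measurable_complex f -> measurable_mx A ->
  measurable_mx (fun x => f x *: A x).
Proof.
by move=> mf mA i j; under eq_fun do rewrite mxE; exact: measurable_complexM.
Qed.

Lemma measurable_mxM m n p (A : S -> 'M[C]_(m, n)) (B : S -> 'M[C]_(n, p)) :
  measurable_mx A -> measurable_mx B -> measurable_mx (fun x => A x *m B x).
Proof.
move=> mA mB i j; under eq_fun do rewrite mxE.
by apply: measurable_complex_sum => k; exact: measurable_complexM.
Qed.

Lemma measurable_mx_sum m n (I : Type) (r : seq I) (A : I -> S -> 'M[C]_(m, n)) :
  (forall i, measurable_mx (A i)) -> measurable_mx (fun x => \sum_(i <- r) A i x).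
Proof.
move=> mA i j; under eq_fun do rewrite summxE.
by apply: measurable_complex_sum => k; exact: mA.
Qed.

Lemma measurable_mxpow n (A : S -> 'M[C]_n) k : measurable_mx A ->
  measurable_mx (fun x => mxpow (A x) k).
Proof.
move=> mA; elim: k => [|k ih]; first exact: measurable_mx_cst.
exact: measurable_mxM.
Qed.

(** A pointwise limit of polynomials in the entries of [A x]; hermiticity enters through the
    convergence of the exponential series. *)
Lemma measurable_expm n (A : S -> 'M[C]_n) s : (forall x, is_hermitian (A x)) ->
  measurable_mx A -> measurable_mx (fun x => expm (Complex 0 s *: A x)).
Proof.
move=> hA mA i j.
apply: (measurable_complex_cvg (f := fun K x => expm_partial (Complex 0 s *: A x) K i j)).
  move=> K; suff : measurable_mx (fun x => expm_partial (Complex 0 s *: A x) K) by apply.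
  rewrite /expm_partial; apply: measurable_mx_sum => k.
  apply: measurable_mxZ; first exact: measurable_complex_cst.
  by apply: measurable_mxpow; apply: measurable_mxZ => //; exact: measurable_complex_cst.
by move=> x; exact: expm_cvg.
Qed.

Lemma measurable_trace_heisenberg n (rho O : 'M[C]_n) (A : S -> 'M[C]_n) t :
  (forall x, is_hermitian (A x)) -> measurable_mx A ->
  measurable_fun setT (fun x => complex.Re (\tr (rho *m heisenberg (A x) O t))).
Proof.
move=> hA mA.
suff [] : measurable_complex (fun x => \tr (rho *m heisenberg (A x) O t)) by [].
rewrite /mxtrace; apply: measurable_complex_sum => i.
apply: (measurable_mxM (measurable_mx_cst rho)).
apply: measurable_mxM; last exact: measurable_expm.
by apply: measurable_mxM; [exact: measurable_expm|exact: measurable_mx_cst].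
Qed.

End ComplexMeasurability.

(** * Sub-Gaussian moment generating functions *)

Section NormalMgf.
Context {R : realType}.
Local Notation mu := (@lebesgue_measure R).
Local Notation nu := (@normal_prob R 0 1).

(** The Radon-Nikodym derivative of the normal law agrees almost everywhere with the density,
    because both have the same integral over every measurable set. *)
Lemma ge0_integral_normal_prob (f : R -> \bar R) : measurable_fun setT f ->
  (forall x, 0 <= f x)%E ->
  (\int[nu]_x f x = \int[mu]_x (f x * (normal_pdf 0 1 x)%:E))%E.
Proof.
move=> mf f0; have dom := @normal_prob_dominates R 0 1.
rewrite -(Radon_Nikodym_SigmaFinite.change_of_variables dom)//.
have iRN := Radon_Nikodym_SigmaFinite.f_integrable dom.
have mpdf : measurable_fun setT (fun x : R => (normal_pdf 0 1 x)%:E).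
  by apply/measurable_EFinP; exact: measurable_normal_pdf.
apply: ae_eq_integral => //.
- by apply: emeasurable_funM => //; exact: (measurable_int mu).
- exact: emeasurable_funM.
- apply: ae_eqe_mul2l => /=.
  apply: integral_ae_eq => //= E _ mE.
  by rewrite -(Radon_Nikodym_SigmaFinite.f_integral dom).
Qed.

Lemma normal_mgf (c : R) : (\int[nu]_x (expR (c * x))%:E = (expR (c ^+ 2 / 2))%:E)%E.
Proof.
have one0 : (1 : R) != 0 by rewrite oner_eq0.
have mexp : measurable_fun setT (fun x : R => (expR (c * x))%:E).
  apply/measurable_EFinP; apply: (measurableT_comp (f := expR)) => //.
have exp0 (x : R) : (0 <= (expR (c * x))%:E)%E by rewrite lee_fin expR_ge0.
(* Completing the square: c x - x^2 / 2 = c^2 / 2 - (x - c)^2 / 2, so the density is recentred at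
   [c]. *)
have pdfE (x : R) : ((expR (c * x))%:E * (normal_pdf 0 1 x)%:E =
    (expR (c ^+ 2 / 2))%:E * (normal_pdf c 1 x)%:E)%E.
  rewrite -!EFinM !normal_pdfE// /normal_fun; congr EFin.
  rewrite mulrCA [RHS]mulrCA -!expRD; congr (_ * expR _).
  by field.
rewrite (ge0_integral_normal_prob mexp exp0); under eq_integral do rewrite pdfE.
rewrite ge0_integralZl_EFin ?expR_ge0 ?integral_normal_pdf ?mule1//.
  by move=> x _; rewrite lee_fin normal_pdf_ge0.
by apply/measurable_EFinP; exact: measurable_normal_pdf.
Qed.

Lemma std_normal_mgf d (T : measurableType d) (P : probability T R) (X : {RV P >-> R}) c :
  std_normal P X -> (\int[P]_w (expR (c * X w))%:E = (expR (c ^+ 2 / 2))%:E)%E.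
Proof.
move=> hX; rewrite -(normal_mgf c).
have mexp : measurable_fun setT (fun x : R => (expR (c * x))%:E).
  apply/measurable_EFinP; apply: (measurableT_comp (f := expR)) => //.
have pos : {in setT, forall x : R, (0 <= (expR (c * x))%:E)%E}.
  by move=> x _; rewrite lee_fin expR_ge0.
(* [lebesgue_measure], hence [normal_prob], lives on [measurableTypeR R], which
   has the same measurable sets as [R] but another display. *)
have mid : measurable_fun setT (fun x : measurableTypeR R => x : R).
  by move=> _ Y mY; rewrite setTI.
have /= <- := ge0_integral_pushforward (measurable_funP X) P measurableT mexp pos.
have /= <- := ge0_integral_pushforward mid nu measurableT mexp pos.
apply: eq_measure_integral => A mA _; exact: hX.
Qed.

(** With p = exp |x| and q = exp |y|, the difference of the two sides is (q - p) (p q - 1) / (p q),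
    and 1 <= p <= q. *)
Lemma cosh_le (x y : R) : `|x| <= `|y| -> expR x + expR (- x) <= expR y + expR (- y).
Proof.
have norm_expR (z : R) : expR z + expR (- z) = expR `|z| + expR (- `|z|).
  have [z0|z0] := leP 0 z; first by rewrite ger0_norm.
  by rewrite ltr0_norm// opprK addrC.
rewrite (norm_expR x) (norm_expR y); move: (normr_ge0 x) => x0 xy.
set a := `|x| in x0 xy *; set b := `|y| in xy *.
have ab : expR a <= expR b by rewrite ler_expR.
have a1 : 1 <= expR a by rewrite -expR0 ler_expR.
have ab' : expR (- b) = expR (- a) * expR (a - b).
  by rewrite -expRD addrA addNr add0r.
rewrite !expRN.
have b1 := le_trans a1 ab.
have a0 : expR a != 0 by rewrite gt_eqF ?expR_gt0.
have b0 : expR b != 0 by rewrite gt_eqF ?expR_gt0.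
rewrite -subr_ge0.
have -> : expR b + (expR b)^-1 - (expR a + (expR a)^-1) =
   (expR b - expR a) * (expR a * expR b - 1) / (expR a * expR b).
  by field; rewrite a0 b0.
apply: mulr_ge0; last by rewrite invr_ge0 mulr_ge0 ?expR_ge0.
apply: mulr_ge0; first by rewrite subr_ge0.
by rewrite subr_ge0 -[leLHS]mulr1 ler_pM.
Qed.


End NormalMgf.

Section SubGaussian.
Context {R : realType}.
Local Open Scope ereal_scope.

Variable nu : probability R R.

(** The independent copy of the symmetrization is the inner variable [y] of an iterated integral, so
    no product space is introduced. Both exponentials factor, which gives closed forms here and,
    after integrating in [x], the value 2 A B. *)
Lemma integral_cosh_diff (h : R -> R) (A B : R) : measurable_fun setT h ->
  \int[nu]_x (expR (h x))%:E = A%:E -> \int[nu]_x (expR (- h x))%:E = B%:E ->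
  forall x, \int[nu]_y (expR (h x - h y) + expR (- (h x - h y)))%:E =
            (expR (h x) * B + expR (- h x) * A)%:E.
Proof.
move=> mh hA hB x.
have m1 : measurable_fun setT (fun y => (expR (h y))%:E).
  by apply/measurable_EFinP; exact: measurableT_comp.
have m2 : measurable_fun setT (fun y => (expR (- h y))%:E).
  apply/measurable_EFinP; apply: (measurableT_comp (f := expR)) => //.
  exact: measurable_funN.
have E y : (expR (h x - h y) + expR (- (h x - h y)))%:E =
    (expR (h x))%:E * (expR (- h y))%:E + (expR (- h x))%:E * (expR (h y))%:E.
  by rewrite opprB (addrC (h y)) !expRD.
under eq_integral do rewrite E.
have p1 y : [set: R] y -> 0 <= (expR (h y))%:E by rewrite lee_fin expR_ge0.
have p2 y : [set: R] y -> 0 <= (expR (- h y))%:E by rewrite lee_fin expR_ge0.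
rewrite ge0_integralD//=; [|exact: measurable_funeM..].
by rewrite !ge0_integralZl_EFin ?expR_ge0// hA hB.
Qed.

Lemma double_integral_cosh_diff (h : R -> R) (A B : R) : measurable_fun setT h ->
  \int[nu]_x (expR (h x))%:E = A%:E -> \int[nu]_x (expR (- h x))%:E = B%:E ->
  0 <= A%:E -> 0 <= B%:E ->
  \int[nu]_x (expR (h x) * B + expR (- h x) * A)%:E = (2 * (A * B))%:E.
Proof.
move=> mh hA hB A0 B0.
have m1 : measurable_fun setT (fun y => (expR (h y))%:E).
  by apply/measurable_EFinP; exact: measurableT_comp.
have m2 : measurable_fun setT (fun y => (expR (- h y))%:E).
  apply/measurable_EFinP; apply: (measurableT_comp (f := expR)) => //.
  exact: measurable_funN.
have E y : (expR (h y) * B + expR (- h y) * A)%:E =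
    B%:E * (expR (h y))%:E + A%:E * (expR (- h y))%:E.
  by rewrite -!EFinM -EFinD mulrC (mulrC A).
under eq_integral do rewrite E.
have p1 y : [set: R] y -> 0 <= (expR (h y))%:E by rewrite lee_fin expR_ge0.
have p2 y : [set: R] y -> 0 <= (expR (- h y))%:E by rewrite lee_fin expR_ge0.
rewrite ge0_integralD//=; [|by move=> y _; rewrite mule_ge0// lee_fin expR_ge0|
  exact: measurable_funeM|by move=> y _; rewrite mule_ge0// lee_fin expR_ge0|
  exact: measurable_funeM].
rewrite !ge0_integralZl_EFin// hA hB -!EFinM -EFinD; congr EFin; ring.
Qed.

Lemma measurable_coshE (h : R -> R) A B : measurable_fun setT h ->
  measurable_fun setT (fun x => (expR (h x) * B + expR (- h x) * A)%:E).
Proof.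
move=> mh; apply/measurable_EFinP; apply: measurable_funD.
  by apply: measurable_funM => //; exact: measurableT_comp.
apply: measurable_funM => //; apply: (measurableT_comp (f := expR)) => //.
exact: measurable_funN.
Qed.

(** A comparison principle: 2 A B and 2 C D are the double integrals of 2 cosh (h x - h y) and 2
    cosh (g x - g y), and the hypothesis on increments orders the integrands pointwise. *)
Lemma mgf_product_le (h g : R -> R) (A B C D : R) :
  measurable_fun setT h -> measurable_fun setT g ->
  \int[nu]_x (expR (h x))%:E = A%:E -> \int[nu]_x (expR (- h x))%:E = B%:E ->
  \int[nu]_x (expR (g x))%:E = C%:E -> \int[nu]_x (expR (- g x))%:E = D%:E ->
  (forall x y, `|h x - h y| <= `|g x - g y|)%R -> (A * B <= C * D)%R.
Proof.
move=> mh mg hA hB hC hD hg.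
have [A0 B0] : 0 <= A%:E /\ 0 <= B%:E.
  by rewrite -hA -hB; split; apply: integral_ge0 => x _; rewrite lee_fin expR_ge0.
have [C0 D0] : 0 <= C%:E /\ 0 <= D%:E.
  by rewrite -hC -hD; split; apply: integral_ge0 => x _; rewrite lee_fin expR_ge0.
rewrite -(@ler_pM2l _ 2%R)// -lee_fin.
rewrite -(double_integral_cosh_diff mh hA hB A0 B0).
rewrite -(double_integral_cosh_diff mg hC hD C0 D0).
apply: ge0_le_integral => //=.
- by move=> x _; rewrite lee_fin addr_ge0// mulr_ge0 ?expR_ge0.
- exact: measurable_coshE.
- exact: measurable_coshE.
move=> x _; rewrite -(integral_cosh_diff mh hA hB x) -(integral_cosh_diff mg hC hD x).
have mc (k : R -> R) : measurable_fun setT k ->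
    measurable_fun setT (fun y => (expR (k x - k y) + expR (- (k x - k y)))%:E).
  move=> mk; apply/measurable_EFinP.
  have mk' : measurable_fun setT (fun y => (k x - k y)%R) by exact: measurable_funB.
  apply: measurable_funD; first exact: measurableT_comp.
  by apply: measurableT_comp => //; exact: measurable_funN.
apply: ge0_le_integral => //=.
- exact: mc.
- exact: mc.
- by move=> y _; rewrite lee_fin cosh_le.
Qed.

End SubGaussian.

Section BoundedIntegral.
Context d (T : measurableType d) {R : realType} (P : probability T R).
Local Open Scope ereal_scope.

Lemma bounded_integral (g : T -> R) K : measurable_fun setT g ->
  (forall x, 0 <= g x <= K)%R ->
  exists2 a : R, \int[P]_x (g x)%:E = a%:E & (0 <= a <= K)%R.
Proof.
move=> mg g0K.
have i0 : 0 <= \int[P]_x (g x)%:E.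
  by apply: integral_ge0 => x _; rewrite lee_fin; have /andP[] := g0K x.
have iK : \int[P]_x (g x)%:E <= K%:E.
  rewrite -[K%:E]mule1 -(@probability_setT _ _ _ P) -integral_cst//.
  apply: ge0_le_integral => //=.
  - by move=> x _; rewrite lee_fin; have /andP[] := g0K x.
  - exact/measurable_EFinP.
  - by move=> x _; rewrite lee_fin; have /andP[] := g0K x.
move: i0 iK; case: (\int[P]_x (g x)%:E) => [a| |] //.
by rewrite !lee_fin => a0 aK; exists a => //; rewrite a0.
Qed.

End BoundedIntegral.

Section SubGaussianLipschitz.
Context {R : realType}.
Variable nu : probability R R.
Hypothesis nu_mgf : forall c : R, (\int[nu]_x (expR (c * x))%:E = (expR (c ^+ 2 / 2))%:E)%E.

(** Stated without centring, with l m in the exponent: in the induction over coordinates the mean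
    [m] becomes a function of the earlier coordinates, so it must stay visible. *)
Lemma mgf_lipschitz (f : R -> R) K b l m : measurable_fun setT f ->
  (forall x, 0 <= f x <= K) -> (forall x y, `|f x - f y| <= b * `|x - y|) ->
  0 <= b -> 0 <= l -> (\int[nu]_x (f x)%:E = m%:E)%E ->
  (\int[nu]_x (expR (l * f x))%:E <= (expR (l ^+ 2 * b ^+ 2 + l * m))%:E)%E.
Proof.
move=> mf f0K fb b0 l0 hm.
have ml c : measurable_fun setT (fun x => c * f x) by exact: measurable_funM.
have mexp c : measurable_fun setT (fun x => expR (c * f x)) by exact: measurableT_comp.
have [A hA /andP[A0 _]] : exists2 a : R, (\int[nu]_x (expR (l * f x))%:E = a%:E)%E & 0 <= a <= expR (l * K).
  apply: bounded_integral => // x; have /andP[fx0 fxK] := f0K x.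
  by rewrite expR_ge0 ler_expR ler_wpM2l.
have [B hB /andP[B0 _]] : exists2 a : R, (\int[nu]_x (expR (- (l * f x)))%:E = a%:E)%E & 0 <= a <= 1.
  apply: bounded_integral.
    by rewrite (_ : (fun x => _) = fun x => expR (- l * f x))//; apply/funext => x; rewrite mulNr.
  move=> x; have /andP[fx0 fxK] := f0K x.
  by rewrite expR_ge0 -expR0 ler_expR oppr_le0 mulr_ge0.
have AB : A * B <= expR (l ^+ 2 * b ^+ 2).
  (* The two Gaussian factors, at l b and - l b, contribute half of the exponent each. *)
  have -> : expR (l ^+ 2 * b ^+ 2) = expR ((l * b) ^+ 2 / 2) * expR ((- (l * b)) ^+ 2 / 2).
    by rewrite -expRD; congr expR; field.
  apply: (@mgf_product_le _ nu (fun x => l * f x) (fun x => l * b * x)) => //.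
  - exact: measurable_funM.
  - by under eq_integral do rewrite -mulNr.
  - move=> x y; rewrite -!mulrBr !normrM (ger0_norm l0) (ger0_norm b0) -mulrA.
    by rewrite ler_wpM2l.
have m0 : 0 <= m.
  rewrite -lee_fin -hm; apply: integral_ge0 => x _.
  by rewrite lee_fin; have /andP[] := f0K x.
have Bm : expR (- (l * m)) <= B.
  (* Jensen, from [1 + u <= e^u], arranged so that all integrands are nonnegative *)
  set e := expR (- (l * m)).
  have e0 : 0 <= e by exact: expR_ge0.
  have -> : (e <= B) = (e * (1 + l * m) <= B + e * l * m) by apply/idP/idP; lra.
  rewrite -lee_fin.
  have -> : ((B + e * l * m)%:E = \int[nu]_x ((expR (- (l * f x)))%:E + (e * l)%:E * (f x)%:E))%E.
    rewrite ge0_integralD//=.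
    - rewrite hB ge0_integralZl_EFin ?mulr_ge0// ?hm -?EFinM//.
        by move=> x _; rewrite lee_fin; have /andP[] := f0K x.
      exact/measurable_EFinP.
    - apply/measurable_EFinP.
      by rewrite (_ : (fun x => _) = fun x => expR (- l * f x))//; apply/funext => x; rewrite mulNr.
    - by move=> x _; rewrite -EFinM lee_fin !mulr_ge0//; have /andP[] := f0K x.
    - by apply: measurable_funeM; exact/measurable_EFinP.
  rewrite -[X in (X <= _)%E]mule1 -(@probability_setT _ _ _ nu) -integral_cst//.
  apply: ge0_le_integral => //=.
  - by move=> x _; rewrite lee_fin mulr_ge0// addr_ge0// mulr_ge0.
  - apply: emeasurable_funD.
      apply/measurable_EFinP.
      by rewrite (_ : (fun x => _) = fun x => expR (- l * f x))//; apply/funext => x; rewrite mulNr.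
    by apply: measurable_funeM; exact/measurable_EFinP.
  - move=> x _; rewrite -EFinM -EFinD lee_fin.
    have := expR_ge1Dx (l * m - l * f x).
    have -> : expR (- (l * f x)) = e * expR (l * m - l * f x).
      by rewrite /e -expRD; congr expR; ring.
    by move=> /(ler_wpM2l e0); lra.
rewrite hA lee_fin expRD.
have := ler_wpM2l A0 Bm => h.
have := le_trans h AB; rewrite expRN ler_pdivrMr ?expR_gt0//.
Qed.

End SubGaussianLipschitz.

(** * Independent samples *)

Section IndependentPair.
Context d d1 (T : measurableType d) (S : measurableType d1) {R : realType}.
Variables (P : probability T R) (Z : {mfun T >-> S}) (Y : {mfun T >-> R}).
Local Open Scope ereal_scope.
Hypothesis indep : forall A B, measurable A -> measurable B ->
  P (Z @^-1` A `&` Y @^-1` B) = P (Z @^-1` A) * P (Y @^-1` B).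

(** Independence on rectangles identifies the law of the pair with the product measure by
    uniqueness. Tonelli then separates the variables, and only the outer one is pulled back to
    [T]. *)
Lemma integral_indep_pair (f : S * R -> \bar R) : measurable_fun setT f ->
  (forall x, 0 <= f x) ->
  \int[P]_w f (Z w, Y w) = \int[P]_w \int[distribution P Y]_y f (Z w, y).
Proof.
move=> mf f0.
have mW : measurable_fun setT (fun w => (Z w, Y w)) by exact: measurable_fun_pair.
have f0' : {in setT, forall x, 0 <= f x} by move=> x _.
have /= <- := ge0_integral_pushforward mW P measurableT mf f0'.
have prodE A B : measurable A -> measurable B ->
    pushforward P (fun w => (Z w, Y w)) (A `*` B) = distribution P Z A * distribution P Y B.
  by move=> mA mB; rewrite -indep.
have -> : \int[pushforward P (fun w => (Z w, Y w))]_y f y =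
    \int[distribution P Z \x distribution P Y]_y f y.
  apply: eq_measure_integral => A mA _.
  by rewrite -(product_measure_unique prodE).
rewrite fubini_tonelli1//.
have mF := measurable_fun_fubini_tonelli_F (m2 := distribution P Y) f mf f0.
have F0 : {in setT, forall x, 0 <= fubini_F (distribution P Y) f x}.
  by move=> x _; apply: integral_ge0 => y _; exact: f0.
by have /= -> := ge0_integral_pushforward (measurable_funP Z) P measurableT mF F0.
Qed.

End IndependentPair.

(** * Tuples of samples: boxes, prefixes and one-coordinate updates *)

Section Boxes.
Context {R : realType} (M : nat).

Definition box (a : 'I_M -> set R) : set (M.-tuple R) :=
  [set z | forall i, a i (tnth z i)].

(** A family stable under intersection that generates the measurable sets of tuples;
    [mutually_independent] speaks about exactly the preimages of such sets. *)
Definition boxes : set (set (M.-tuple R)) :=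
  [set A | exists2 a, (forall i, measurable (a i)) & A = box a].

Lemma measurable_box a : (forall i, measurable (a i)) -> measurable (box a).
Proof.
move=> ma; have -> : box a = \big[setI/setT]_(i < M) ((fun z => tnth z i) @^-1` a i).
  apply/seteqP; split => z /=.
    by move=> za; elim/big_ind : _ => // i _; exact: za.
  rewrite -bigcap_seq => za i; apply: za => /=; exact: mem_index_enum.
apply: bigsetI_measurable => i _; rewrite -[X in measurable X]setTI.
exact: measurable_tnth.
Qed.

Lemma measurable_tupleE : measurable = <<s boxes >> :> set (set (M.-tuple R)).
Proof.
apply/seteqP; split; apply: smallest_sub.
- exact: smallest_sigma_algebra.
- rewrite -bigcup_seq => A [i _ [Y mY <-]]; apply: sub_sigma_algebra.
  (* A generating cylinder is a box whose sides are all full except one. *)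
  exists (fun j => if j == i then Y else setT) => [j|]; first by case: ifP.
  apply/seteqP; split => z /=.
    by move=> [_ Yz] j; case: eqP => /= [->|].  
  by move=> /(_ i); rewrite eqxx; split.
- exact: sigma_algebra_measurable.
- by move=> _ [a ma ->]; exact: measurable_box.
Qed.

Lemma boxes_setI_closed : setI_closed boxes.
Proof.
move=> _ _ [a ma ->] [b mb ->]; exists (fun i => a i `&` b i).
  by move=> i; exact: measurableI.
apply/seteqP; split => z /=; first by move=> [h1 h2] i.
by move=> h; split => i; have [] := h i.
Qed.

(** Padding with zeros instead of truncating keeps all prefixes in one measurable space, so the
    induction on [k] never changes type. *)
Definition prefix_tuple (z : M.-tuple R) (k : nat) : M.-tuple R :=
  [tuple if (i < k)%N then tnth z i else 0 | i < M].

Definition set_tuple (z : M.-tuple R) (i : 'I_M) (y : R) : M.-tuple R :=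
  [tuple if j == i then y else tnth z j | j < M].

Lemma prefix_tupleS z (i : 'I_M) :
  prefix_tuple z i.+1 = set_tuple (prefix_tuple z i) i (tnth z i).
Proof.
apply: eq_from_tnth => j; rewrite !tnth_mktuple ltnS leq_eqVlt -val_eqE /=.
by case: eqP => // /val_inj ->.
Qed.

Lemma prefix_tuple_full z : prefix_tuple z M = z.
Proof. by apply: eq_from_tnth => j; rewrite tnth_mktuple ltn_ord. Qed.

Lemma prefix_tuple0 z : prefix_tuple z 0 = [tuple 0 | i < M].
Proof. by apply: eq_from_tnth => j; rewrite !tnth_mktuple. Qed.

Lemma set_tuple_id z i x y : set_tuple (set_tuple z i x) i y = set_tuple z i y.
Proof. by apply: eq_from_tnth => j; rewrite !tnth_mktuple; case: eqP. Qed.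

Lemma set_tupleC z i j x y : i != j ->
  set_tuple (set_tuple z i x) j y = set_tuple (set_tuple z j y) i x.
Proof.
move=> ij; apply: eq_from_tnth => k; rewrite !tnth_mktuple.
by case: eqP => // ->; rewrite eq_sym (negbTE ij).
Qed.

Lemma measurable_prefix_tuple k : measurable_fun setT (prefix_tuple ^~ k).
Proof.
apply/measurable_fun_tnthP => i /=.
rewrite (_ : _ \o _ = fun z => if (i < k)%N then tnth z i else 0); last first.
  by apply/funext => z /=; rewrite tnth_mktuple.
by case: (i < k)%N; [exact: measurable_tnth|exact: measurable_cst].
Qed.

Lemma measurable_set_tuple i : measurable_fun setT (fun p : M.-tuple R * R => set_tuple p.1 i p.2).
Proof.
apply/measurable_fun_tnthP => j /=.
rewrite (_ : _ \o _ = fun p => if j == i then p.2 else tnth p.1 j); last first.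
  by apply/funext => z /=; rewrite tnth_mktuple.
case: (j == i); first exact: measurable_snd.
exact: (measurableT_comp (measurable_tnth _) measurable_fst).
Qed.

Definition coord_lipschitz (b : R) (G : M.-tuple R -> R) :=
  forall z i x y, `|G (set_tuple z i x) - G (set_tuple z i y)| <= b * `|x - y|.

(** Covers the degenerate cases in which the Chernoff parameter a / (2 b sqrt M) would divide by
    zero. For b = 0 the tuple is emptied coordinate by coordinate, without changing the value of
    [G]. *)
Lemma coord_lipschitz_const b G : coord_lipschitz b G -> b = 0 \/ M = 0%N ->
  forall z, G z = G [tuple 0 | i < M].
Proof.
move=> GL bM z; rewrite -{1}(prefix_tuple_full z) -(prefix_tuple0 z).
case: bM => [b0|->//].
suff h k : (k <= M)%N -> G (prefix_tuple z k) = G (prefix_tuple z 0) by exact: h.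
elim: k => // k ih kM; rewrite -ih ?(ltnW kM)//.
rewrite (prefix_tupleS z (Ordinal kM)) /=.
(* Coordinate [k] is reset to its own value, so that both arguments are updates of one tuple and the
   Lipschitz bound applies. *)
have -> : prefix_tuple z k = set_tuple (prefix_tuple z k) (Ordinal kM) (tnth (prefix_tuple z k) (Ordinal kM)).
  by apply: eq_from_tnth => j; rewrite [in RHS]tnth_mktuple; case: eqP => // ->.
set p := prefix_tuple _ _; apply/eqP; rewrite -subr_eq0 -normr_le0.
by rewrite set_tuple_id (le_trans (GL _ _ _ _))// b0 mul0r.
Qed.

End Boxes.

(** * Independence of a prefix from the next sample *)

Section PrefixIndependence.
Context d (T : measurableType d) {R : realType} (P : probability T R) (M : nat).
Variable theta : 'I_M -> {RV P >-> R}.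
Hypothesis indep : mutually_independent P (fun i => (theta i : T -> R)).

Definition sample (w : T) : M.-tuple R := [tuple theta i w | i < M].

Lemma measurable_sample : measurable_fun setT sample.
Proof.
apply/measurable_fun_tnthP => i.
rewrite (_ : _ \o _ = theta i) //.
by apply/funext => w /=; rewrite tnth_mktuple.
Qed.

Definition prefix_sample k w := prefix_tuple (sample w) k.

Lemma measurable_prefix_sample k : measurable_fun setT (prefix_sample k).
Proof. exact: measurableT_comp (measurable_prefix_tuple k) measurable_sample. Qed.

HB.instance Definition _ k := @isMeasurableFun.Build _ _ T (M.-tuple R)
  (prefix_sample k) (measurable_prefix_sample k).

Let setT_theta i (A : set R) : measurable A -> measurable (theta i @^-1` A).
Proof. exact: measurable_funPTI. Qed.

Lemma prefix_indep_box (k : 'I_M) a B : (forall i, measurable (a i)) -> measurable B ->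
  (P (prefix_sample k @^-1` (box a) `&` theta k @^-1` B) =
  P (prefix_sample k @^-1` (box a)) * P (theta k @^-1` B))%E.
Proof.
move=> ma mB.
(* From coordinate [k] on, the prefix is constantly 0, so the side [a' i] is everything or empty
   according to whether 0 lies in [a i]. *)
pose a' i := [set x | a i (if (i < k)%N then x else 0)].
have ma' i : measurable (a' i).
  rewrite /a'; case: (i < k)%N => [|]; first exact: ma.
  have [h|h] := pselect (a i 0).
    by rewrite (_ : [set x : R | a i 0] = setT)//; apply/seteqP; split => x.
  by rewrite (_ : [set x : R | a i 0] = set0)//; apply/seteqP; split => x.
pose a2 i := if i == k then a' k `&` B else a' i.
have ma2 i : measurable (a2 i).
  by rewrite /a2; case: ifP => // _; exact: measurableI.
have E1 : prefix_sample k @^-1` (box a) = \bigcap_(i in [set: 'I_M]) (theta i @^-1` a' i).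
  apply/seteqP; split => w /=.
    by move=> h i _; have := h i; rewrite !tnth_mktuple.
  by move=> h i; have := h i Logic.I; rewrite !tnth_mktuple.
have E2 : prefix_sample k @^-1` (box a) `&` theta k @^-1` B =
    \bigcap_(i in [set: 'I_M]) (theta i @^-1` a2 i).
  rewrite E1; apply/seteqP; split => w /=.
    move=> [h Bw] i _; rewrite /a2; case: eqP => [->|_]; last exact: h.
    by split => //; exact: h.
  move=> h; split => [i _|].
    have := h i Logic.I; rewrite /a2; case: eqP => [->|//]; by case.
  by have := h k Logic.I; rewrite /a2 eqxx => -[].
rewrite E2 E1 !indep// -[P (theta k @^-1` B)]fineK ?fin_num_measure//; last exact: setT_theta.
rewrite -EFinM; congr EFin.
(* Only factor [k] differs between the two products; there [a' k] is full or empty, and in either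
   case intersecting with [B] multiplies the probabilities. *)
rewrite (bigD1 k)//= [in RHS](bigD1 k)//= mulrAC; congr (_ * _).
  rewrite {1}/a2 eqxx /a' ltnn; have [h|h] := pselect (a k 0).
    have -> : [set x : R | a k 0] = setT by apply/seteqP; split => x.
    by rewrite setTI preimage_setT probability_setT mul1r.
  have -> : [set x : R | a k 0] = set0 by apply/seteqP; split => x.
  by rewrite set0I preimage_set0 measure0 mul0r.
by apply: eq_bigr => i /negbTE ik; rewrite /a2 ik.
Qed.

(** For fixed [B], both sides are finite measures in [A]: [P] restricted to the event of [B] and
    pushed forward, and the law of the prefix scaled by a constant. They agree on boxes, hence
    everywhere. *)
Lemma prefix_indep (k : 'I_M) A B : measurable A -> measurable B ->
  (P (prefix_sample k @^-1` A `&` theta k @^-1` B) =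
  P (prefix_sample k @^-1` A) * P (theta k @^-1` B))%E.
Proof.
move=> mA mB.
have mE : measurable (theta k @^-1` B) by exact: setT_theta.
have fE : P (theta k @^-1` B) \is a fin_num by exact: fin_num_measure.
have pE : 0 <= fine (P (theta k @^-1` B)) by rewrite fine_ge0.
pose m1 := pushforward (mrestr P mE) (prefix_sample k : T -> M.-tuple R).
pose m2 := mscale (NngNum pE) (distribution P (prefix_sample k)).
have : m1 A = m2 A.
  have mp := measurable_prefix_sample k.
  apply: (measure_unique (@boxes R M) (fun=> setT)) => //.
  - exact: measurable_tupleE.
  - exact: boxes_setI_closed.
  - by move=> _; exists (fun=> setT) => //; apply/seteqP; split.
  - by rewrite bigcup_const.
  - move=> _ [a ma ->].
    transitivity (P (prefix_sample k @^-1` box a) * P (theta k @^-1` B))%E.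
      exact: prefix_indep_box.
    by rewrite -[RHS]/((fine (P (theta k @^-1` B)))%:E * _)%E fineK// muleC.
  - move=> _; rewrite (@le_lt_trans _ _ 1%E) ?ltry//.
    apply: (@probability_le1 _ _ _ P (_ `&` _)); apply: measurableI => //; exact: measurableT.
move=> h; rewrite [RHS]muleC -[X in _ = (X * _)%E]fineK//; exact: h.
Qed.

End PrefixIndependence.

(** * Concentration of coordinatewise Lipschitz functions *)

Lemma integral_cst_probability d (T : measurableType d) (R : realType)
    (P : probability T R) (r : R) : (\int[P]_x r%:E = r%:E)%E.
Proof. by rewrite -[RHS]mule1 -(@probability_setT _ _ _ P) -integral_cst. Qed.

Lemma le_integral_shift d (T : measurableType d) (R : realType) (P : probability T R)
    (f g : T -> R) K c a a' :
  measurable_fun setT f -> measurable_fun setT g ->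
  (forall x, 0 <= f x <= K) -> (forall x, 0 <= g x <= K) -> 0 <= c ->
  (forall x, f x <= g x + c) ->
  (\int[P]_x (f x)%:E = a%:E)%E -> (\int[P]_x (g x)%:E = a'%:E)%E -> a <= a' + c.
Proof.
move=> mf mg f0 g0 c0 fg fa ga.
have mg' : measurable_fun setT (fun x => (g x)%:E) by exact/measurable_EFinP.
rewrite -lee_fin EFinD -ga -fa.
rewrite -[c%:E](integral_cst_probability P).
rewrite -ge0_integralD//=.
- apply: ge0_le_integral => //=.
  + by move=> x _; rewrite lee_fin; have /andP[] := f0 x.
  + exact/measurable_EFinP.
  + exact: emeasurable_funD.
- by move=> x _; rewrite lee_fin; have /andP[] := g0 x.
- by move=> x _; rewrite lee_fin; have /andP[] := g0 x.
Qed.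

Section Concentration.
Context d (T : measurableType d) {R : realType} (P : probability T R) (M : nat).
Variable theta : 'I_M -> {RV P >-> R}.
Hypothesis indep : mutually_independent P (fun i => (theta i : T -> R)).
Hypothesis theta_mgf : forall i (c : R),
  (\int[P]_w (expR (c * theta i w))%:E = (expR (c ^+ 2 / 2))%:E)%E.

Local Notation Z := (prefix_sample theta).

Lemma distribution_mgf i (c : R) :
  (\int[distribution P (theta i)]_x (expR (c * x))%:E = (expR (c ^+ 2 / 2))%:E)%E.
Proof.
have mexp : measurable_fun setT (fun x : R => (expR (c * x))%:E).
  by apply/measurable_EFinP; apply: (measurableT_comp (f := expR)).
have pos : {in setT, forall x : R, (0 <= (expR (c * x))%:E)%E}.
  by move=> x _; rewrite lee_fin expR_ge0.
by have /= -> := ge0_integral_pushforward (measurable_funP (theta i)) P measurableT mexp pos.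
Qed.

Lemma integral_prefixS (i : 'I_M) (f : M.-tuple R -> \bar R) : measurable_fun setT f ->
  (forall z, 0 <= f z)%E ->
  (\int[P]_w f (Z i.+1 w) =
   \int[P]_w \int[distribution P (theta i)]_y f (set_tuple (Z i w) i y))%E.
Proof.
move=> mf f0.
have mf' : measurable_fun setT (fun p : M.-tuple R * R => f (set_tuple p.1 i p.2)).
  exact: measurableT_comp mf (measurable_set_tuple i).
have ind A B : measurable A -> measurable B ->
    (P (Z i @^-1` A `&` theta i @^-1` B) = P (Z i @^-1` A) * P (theta i @^-1` B))%E.
  by move=> mA mB; exact: prefix_indep.
have /= <- := integral_indep_pair ind mf' (fun p => f0 _).
by apply: eq_integral => w _; rewrite /prefix_sample prefix_tupleS tnth_mktuple.
Qed.

(** Induction with [G] general: averaging over the last coordinate of the prefix yields a function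
    to which the hypothesis applies with the same [K], [b] and [m], at the price of one factor exp
    (l^2 b^2). *)
Lemma mgf_prefix (k : nat) (G : M.-tuple R -> R) (K b l m : R) : (k <= M)%N ->
  measurable_fun setT G -> (forall z, 0 <= G z <= K) -> coord_lipschitz b G ->
  0 <= b -> 0 <= l -> (\int[P]_w (G (Z k w))%:E = m%:E)%E ->
  (\int[P]_w (expR (l * G (Z k w)))%:E <= (expR (k%:R * (l ^+ 2 * b ^+ 2) + l * m))%:E)%E.
Proof.
move=> + + + + b0 l0; elim: k G m => [|k ih] G m kM mG G0K GL hm.
  have Zc w : Z 0 w = [tuple 0 | i < M] by exact: prefix_tuple0.
  have mE : m = G [tuple 0 | i < M].
    apply: EFin_inj; rewrite -hm; under eq_integral do rewrite Zc.
    by rewrite integral_cst_probability.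
  under eq_integral do rewrite Zc.
  by rewrite integral_cst_probability mul0r add0r mE.
pose i := Ordinal kM; pose nu := distribution P (theta i).
have msec (z : M.-tuple R) : measurable_fun setT (fun y => set_tuple z i y).
  exact: (measurableT_comp (measurable_set_tuple i) (measurable_pair1 z)).
have mGsec (z : M.-tuple R) : measurable_fun setT (fun y => G (set_tuple z i y)).
  exact: (measurableT_comp mG (msec z)).
(* The conditional expectation of [G] given the earlier coordinates; [fine] loses nothing because
   the integral lies between 0 and [K]. *)
pose G' (z : M.-tuple R) := fine (\int[nu]_y (G (set_tuple z i y))%:E)%E.
have hG' z : (\int[nu]_y (G (set_tuple z i y))%:E = (G' z)%:E)%E /\ 0 <= G' z <= K.
  have [a ha a0K] := bounded_integral nu (mGsec z) (fun y => G0K (set_tuple z i y)).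
  by rewrite /G' ha.
have mprod : measurable_fun setT (fun p : M.-tuple R * R => (G (set_tuple p.1 i p.2))%:E).
  by apply/measurable_EFinP; exact: measurableT_comp mG (measurable_set_tuple i).
have mG' : measurable_fun setT G'.
  apply: (measurableT_comp (f := fine)) => //.
  apply: (measurable_fun_fubini_tonelli_F (m2 := nu) _ mprod).
  by move=> p; rewrite lee_fin; have /andP[] := G0K (set_tuple p.1 i p.2).
have G'1 z j x y : G' (set_tuple z j x) <= G' (set_tuple z j y) + b * `|x - y|.
  apply: (@le_integral_shift _ _ _ nu (fun u => G (set_tuple (set_tuple z j x) i u))
     (fun u => G (set_tuple (set_tuple z j y) i u)) K) => //; last 2 first.
  - exact: (hG' _).1.
  - exact: (hG' _).1.
  - by rewrite mulr_ge0.
  move=> u; rewrite -lerBlDl (le_trans (ler_norm _))//.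
  (* A change in the averaged coordinate is overwritten; any other update commutes with the
     averaging. *)
  have [->|ji] := eqVneq j i.
    by rewrite !set_tuple_id subrr normr0 mulr_ge0.
  by rewrite !(set_tupleC _ _ _ ji); exact: GL.
have GL' : coord_lipschitz b G'.
  move=> z j x y; have h1 := G'1 z j x y; have := G'1 z j y x; rewrite distrC => h2.
  by rewrite ler_norml; apply/andP; split; lra.
have hm' : (\int[P]_w (G' (Z k w))%:E = m%:E)%E.
  rewrite -hm -[k.+1]/(i.+1) (integral_prefixS i (f := fun z => (G z)%:E)).
  - by apply: eq_integral => w _; rewrite (hG' _).1.
  - exact/measurable_EFinP.
  - by move=> z; rewrite lee_fin; have /andP[] := G0K z.
have := ih G' m (ltnW kM) mG' (fun z => (hG' z).2) GL' hm' => ihG.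
have mexp (F : M.-tuple R -> R) : measurable_fun setT F -> measurable_fun setT (fun z => (expR (l * F z))%:E).
  move=> mF; apply/measurable_EFinP; apply: measurableT_comp => //.
  exact: measurable_funM.
rewrite -[k.+1]/(i.+1) (integral_prefixS i (f := fun z => (expR (l * G z))%:E)); last first.
- by move=> z; rewrite lee_fin expR_ge0.
- exact: mexp.
apply: (@le_trans _ _ (\int[P]_w ((expR (l ^+ 2 * b ^+ 2))%:E * (expR (l * G' (Z k w)))%:E)%E)%E).
  apply: ge0_le_integral => //=.
  - by move=> w _; apply: integral_ge0 => y _; rewrite lee_fin expR_ge0.
  - have h := measurable_fun_fubini_tonelli_F (m2 := nu) (fun p => (expR (l * G (set_tuple p.1 i p.2)))%:E).
    apply: (measurableT_comp (h _ _) (measurable_prefix_sample theta k)).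
      exact: (measurableT_comp (mexp _ mG) (measurable_set_tuple i)).
    by move=> p; rewrite lee_fin expR_ge0.
  - apply: measurable_funeM.
    exact: (measurableT_comp (mexp _ mG') (measurable_prefix_sample theta k)).
  - move=> w _; rewrite -EFinM -expRD.
    (* The one-variable bound for the section of [G] at the current prefix, whose mean is [G']
       there. *)
    apply: (mgf_lipschitz (distribution_mgf i) (K := K)) => //.
    + exact: (hG' _).1.
rewrite ge0_integralZl_EFin ?expR_ge0//; last first.
- exact: (measurableT_comp (mexp _ mG') (measurable_prefix_sample theta k)).
rewrite -natr1 mulrDl mul1r addrAC addrC expRD EFinM lee_pmul2l ?lte_fin ?expR_gt0//.
Qed.

Local Notation S := (sample theta).

Lemma mgf_sample (F : M.-tuple R -> R) (K b l m : R) :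
  measurable_fun setT F -> (forall z, 0 <= F z <= K) -> coord_lipschitz b F ->
  0 <= b -> 0 <= l -> (\int[P]_w (F (S w))%:E = m%:E)%E ->
  (\int[P]_w (expR (l * F (S w)))%:E <= (expR (M%:R * (l ^+ 2 * b ^+ 2) + l * m))%:E)%E.
Proof.
move=> mF F0 FL b0 l0 hm.
have ZS w : Z M w = S w by exact: prefix_tuple_full.
have := @mgf_prefix M F K b l m (leqnn _) mF F0 FL b0 l0.
under eq_integral do rewrite ZS; under [X in (_ -> X <= _)%E -> _]eq_integral do rewrite ZS.
exact.
Qed.

Lemma upper_tail (F : M.-tuple R -> R) (K b m a : R) :
  measurable_fun setT F -> (forall z, 0 <= F z <= K) -> coord_lipschitz b F ->
  0 < b -> (0 < M)%N -> (\int[P]_w (F (S w))%:E = m%:E)%E -> 0 < a ->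
  (P [set w | (m + a * b * Num.sqrt M%:R <= F (S w))%R] <= (expR (- (a ^+ 2 / 4)))%:E)%E.
Proof.
move=> mF F0 FL b0 M0 hm a0.
set q := Num.sqrt M%:R.
have q0 : 0 < q by rewrite sqrtr_gt0 ltr0n.
(* The minimizer of M l^2 b^2 - l a b sqrt M, whose minimum is - a^2 / 4. *)
pose l := a / (2 * b * q).
have l0 : 0 < l by rewrite divr_gt0// !mulr_gt0.
have mX : measurable_fun setT (F \o S) by exact: measurableT_comp mF (measurable_sample theta).
pose X : {RV P >-> R} := HB.pack (F \o S) (@isMeasurableFun.Build _ _ T R (F \o S) mX).
have := chernoff X (m + a * b * q) l0.
rewrite /mmt_gen_fun expectation.unlock => h; apply: (le_trans h).
have -> : (\int[P]_w ((expR \o l \o* X) w)%:E = \int[P]_w (expR (l * F (S w)))%:E)%E.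
  by apply: eq_integral => w _ /=; rewrite mulrC.
have := mgf_sample mF F0 FL (ltW b0) (ltW l0) hm => h2.
apply: (@le_trans _ _ ((expR (M%:R * (l ^+ 2 * b ^+ 2) + l * m))%:E * (expR (- (l * (m + a * b * q))))%:E)%E).
  by rewrite lee_pmul2r// lte_fin expR_gt0.
rewrite -EFinM -expRD lee_fin ler_expR.
have -> : M%:R = q ^+ 2 by rewrite sqr_sqrtr.
rewrite le_eqVlt; apply/orP; left; apply/eqP; rewrite /l; field.
by rewrite !gt_eqF.
Qed.

Lemma concentration (F : M.-tuple R -> R) (K b m a : R) :
  measurable_fun setT F -> (forall z, 0 <= F z <= K) -> coord_lipschitz b F ->
  0 <= b -> (\int[P]_w (F (S w))%:E = m%:E)%E -> 0 < a ->
  ((1 - 2 * expR (- (a ^+ 2 / 4)))%:E <=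
   P [set w | (`|F (S w) - m| <= a * b * Num.sqrt M%:R)%R])%E.
Proof.
move=> mF F0 FL b0 hm a0.
have mX : measurable_fun setT (fun w => F (S w)) by exact: measurableT_comp mF (measurable_sample theta).
have [bM|[b1 M1]] : (b = 0 \/ M = 0%N) \/ 0 < b /\ (0 < M)%N.
  have [M0|M0] := posnP M; first by left; right.
  have [->|bn] := eqVneq b 0; first by left; left.
  by right; split => //; rewrite lt0r bn.
  have FS w : F (S w) = m.
    rewrite (coord_lipschitz_const FL bM); apply: EFin_inj; rewrite -hm.
    under eq_integral do rewrite (coord_lipschitz_const FL bM).
    by rewrite integral_cst_probability.
  rewrite (_ : [set w | _] = setT) ?probability_setT; last first.
    apply/seteqP; split => // w _ /=; rewrite FS subrr normr0.
    exact: mulr_ge0 (mulr_ge0 (ltW a0) b0) (sqrtr_ge0 _).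
  by rewrite lee_fin lerBlDl lerDr mulr_ge0 ?expR_ge0.
set s := a * b * _.
have up := upper_tail mF F0 FL b1 M1 hm a0.
(* Reflection preserves the range and the Lipschitz constant and turns the lower tail into an upper
   one; the union of the two tails accounts for the factor 2. *)
pose F' z := K - F z.
have mF' : measurable_fun setT F' by exact: measurable_funB.
have F0' z : 0 <= F' z <= K.
  by have /andP[h1 h2] := F0 z; rewrite subr_ge0 h2 /= gerBl.
have FL' : coord_lipschitz b F'.
  move=> z i x y; rewrite /F'.
  have -> (u v : R) : K - u - (K - v) = v - u by ring.
  by rewrite distrC; exact: FL.
have hm' : (\int[P]_w (F' (S w))%:E = (K - m)%:E)%E.
  have [m' hm'' _] := bounded_integral P (g := fun w => F' (S w)) (K := K) 
    (measurableT_comp mF' (measurable_sample theta)) (fun w => F0' (S w)).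
  suff : ((m + m')%:E = K%:E)%E by move=> [<-]; rewrite hm'' (addrC m) addrK.
  rewrite EFinD -hm -hm'' -ge0_integralD//.
  - under eq_integral do rewrite -EFinD /F' addrC subrK.
    by rewrite integral_cst_probability.
  - by move=> w _; rewrite lee_fin; have /andP[] := F0 (S w).
  - exact/measurable_EFinP.
  - by move=> w _; rewrite lee_fin; have /andP[] := F0' (S w).
  - by apply/measurable_EFinP; exact: measurableT_comp mF' (measurable_sample theta).
have low := upper_tail mF' F0' FL' b1 M1 hm' a0.
rewrite -/s in up low.
set U := [set w | (m + s <= F (S w))%R] in up.
set L := [set w | _] in low.
set A := [set w | _].
have mle (u v : T -> R) : measurable_fun setT u -> measurable_fun setT v ->
    measurable [set w | u w <= v w].
  move=> mu mv; rewrite -[X in measurable X]setTI.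
  exact: (measurable_fun_ler mu mv measurableT (Y := [set true])).
have mX' : measurable_fun setT (fun w => F' (S w)).
  exact: measurableT_comp mF' (measurable_sample theta).
have mU : measurable U by exact: mle.
have mL : measurable L by exact: mle.
have mA : measurable A.
  apply: (mle (fun w => `|F (S w) - m|)) => //.
  exact: (measurableT_comp (@normr_measurable R setT) (measurable_funB mX (measurable_cst m))).
have AUL : ~` A `<=` U `|` L.
  move=> w /= /negP; rewrite -ltNge lter_normr => /orP[h|h]; [left|right].
    by rewrite /U /=; lra.
  by rewrite /L /= /F'; lra.
have : (P (~` A) <= (2 * expR (- (a ^+ 2 / 4)))%:E)%E.
  apply: (le_trans (le_measure _ _ _ AUL)); rewrite ?inE//.
  - exact: measurableC.
  - exact: measurableU.
  apply: (le_trans (measureU2 _ mU mL)).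
  by rewrite mulr_natl mulr2n EFinD leeD.
have fA : P A \is a fin_num by exact: fin_num_measure.
rewrite probability_setC// leeBlDr// => h.
by rewrite EFinB leeBlDr// addeC.
Qed.

End Concentration.

(** * Noisy Hamiltonians *)

Section NoisyExpectation.
Context {R : realType} (n M : nat).
Variables (H : 'M[R[i]]_n) (V : 'I_M -> 'M[R[i]]_n) (chi : 'I_M -> R -> R).
Variables (delta t : R) (rho O : 'M[R[i]]_n).
Hypothesis hH : is_hermitian H.
Hypothesis hV : forall i, is_hermitian (V i) /\ opnorm (V i) <= 1.
Hypothesis chi_derivable : forall i (x : R), derivable (chi i) x 1.
Hypothesis chi_derive : forall i (x : R), `|derive1 (chi i) x| <= delta.
Hypothesis t0 : 0 <= t.
Hypothesis hrho : density_matrix rho.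

(** A deterministic function of the underlying Gaussian values, with the deformations [chi i]
    inside, so that all randomness enters through the tuple [z]. *)
Definition noisy_hamiltonian (z : M.-tuple R) : 'M[R[i]]_n :=
  H + \sum_(i < M) cplx (chi i (tnth z i)) *: V i.

Definition noisy_mean (z : M.-tuple R) : R :=
  complex.Re (\tr (rho *m heisenberg (noisy_hamiltonian z) O t)).

Lemma noisy_hamiltonian_hermitian z : is_hermitian (noisy_hamiltonian z).
Proof.
apply: is_hermitianD => //; apply: is_hermitian_sum => i.
by apply: is_hermitianZ; case: (hV i).
Qed.

Lemma noisy_hamiltonianB z i x y :
  noisy_hamiltonian (set_tuple z i x) - noisy_hamiltonian (set_tuple z i y) =
  cplx (chi i x - chi i y) *: V i.
Proof.
rewrite /noisy_hamiltonian opprD addrACA subrr add0r -sumrB (bigD1 i)//= big1 => [|j ji].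
  rewrite addr0 !tnth_mktuple eqxx -scalerBl; congr (_ *: _); complex_ring.
by rewrite !tnth_mktuple (negbTE ji) subrr.
Qed.

Lemma measurable_noisy_mean : measurable_fun setT noisy_mean.
Proof.
apply: measurable_trace_heisenberg; first exact: noisy_hamiltonian_hermitian.
apply: measurable_mxD; first exact: measurable_mx_cst.
apply: measurable_mx_sum => i; apply: measurable_mxZ; last exact: measurable_mx_cst.
split => /=; last exact: measurable_cst.
apply: (measurableT_comp _ (measurable_tnth i)).
apply: continuous_measurable_fun => x.
by apply/differentiable_continuous/derivable1_diffP; exact: chi_derivable.
Qed.

Lemma noisy_mean_lipschitz : coord_lipschitz (2 * opnorm O * t * delta) noisy_mean.
Proof.
move=> z i x y.
apply: (@le_trans _ _ (2 * opnorm O * `|t| * `|chi i x - chi i y|)).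
  apply: trace_heisenberg_lipschitz => //; [exact: noisy_hamiltonian_hermitian..|].
  move=> v; rewrite noisy_hamiltonianB -scalemxAl vnormZ cabs_cplx ler_wpM2l//.
  rewrite (le_trans (opnorm_bound _ _))// -[leRHS]mul1r ler_wpM2r//.
  by case: (hV i).
rewrite ger0_norm// -[leRHS]mulrA ler_wpM2l//.
  exact: mulr_ge0 (mulr_ge0 (ler0n _ 2) (opnorm_ge0 _)) t0.
exact: derive1_lipschitz.
Qed.

Lemma noisy_mean_bound z : `|noisy_mean z| <= opnorm O.
Proof. exact: trace_heisenberg_bound hrho (noisy_hamiltonian_hermitian z). Qed.

End NoisyExpectation.

Unset Implicit Arguments.

Theorem theorem5 (R : realType) :
  exists c : R, 0 < c /\
  forall (d : measure_display) (T : measurableType d) (P : probability T R)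
    (N M : nat) (H : 'M[R[i]]_(2 ^ N)) (V : 'I_M -> 'M[R[i]]_(2 ^ N))
    (theta : 'I_M -> {RV P >-> R}) (chi : 'I_M -> R -> R)
    (delta : R) (Gamma : \bar R) (t a : R)
    (rho O : 'M[R[i]]_(2 ^ N)),
    is_hermitian H ->
    (forall i, is_hermitian (V i) /\ opnorm (V i) <= 1) ->
    0 < delta -> (0 < Gamma)%E ->
    (forall i, chi_deform delta Gamma (chi i)) ->
    (forall i, std_normal P (theta i)) ->
    mutually_independent P (fun i => (theta i : T -> R)) ->
    (forall i, P.-integrable setT (fun w => (chi i (theta i w))%:E)) ->
    (forall i, ('E_P[fun w => chi i (theta i w)] = 0)%E) ->
    0 <= t -> Num.sqrt N%:R * t * delta <= 1 ->
    density_matrix rho -> is_hermitian O -> 0 < a ->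
    let g i w := chi i (theta i w) in
    let X w := \tr (rho *m heisenberg (H + \sum_(i < M) Complex (g i w) 0 *: V i) O t) in
    let EX := Complex (fine ('E_P[fun w => complex.Re (X w)])%E) (fine ('E_P[fun w => complex.Im (X w)])%E) in
    ((1 - 2 * expR (- (c * a ^+ 2)))%:E <=
     P [set w | (cabs (X w - EX) <= 2 * a * opnorm O * Num.sqrt M%:R * t * delta)%R])%E.
Proof.
exists 4^-1; split; first by rewrite invr_gt0.
move=> d T P N M H V theta chi delta Gamma t a rho O hH hV delta0 _ hchi htheta indep _ _ t0 _
  hrho hO a0; cbv zeta.
pose g i w := chi i (theta i w).
pose X w := \tr (rho *m heisenberg (H + \sum_(i < M) Complex (g i w) 0 *: V i) O t).
pose EX := Complex (fine ('E_P[fun w => complex.Re (X w)])%E)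
                   (fine ('E_P[fun w => complex.Im (X w)])%E).
change ((1 - 2 * expR (- (4^-1 * a ^+ 2)))%:E <=
  P [set w | (cabs (X w - EX) <= 2 * a * opnorm O * Num.sqrt M%:R * t * delta)%R])%E.
have chiD i x : derivable (chi i) x 1 by case: (hchi i) => -[].
have chid i x : `|derive1 (chi i) x| <= delta by case: (hchi i) => -[].
(* An opaque [f] keeps unification from unfolding [heisenberg]. *)
have [f [mf fb fL fE]] : exists f : M.-tuple R -> R,
    [/\ measurable_fun setT f, forall z, `|f z| <= opnorm O,
        coord_lipschitz (2 * opnorm O * t * delta) f &
        forall z, f z = noisy_mean H V chi t rho O z].
  exists (noisy_mean H V chi t rho O); split => //.
  - exact: measurable_noisy_mean.
  - exact: noisy_mean_bound.
  - exact: noisy_mean_lipschitz.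
(* The shift puts the values between 0 and 2 |O|, as the concentration bound requires, and cancels
   in the deviation from the mean. *)
pose F z := f z + opnorm O.
have mF : measurable_fun setT F by exact: measurable_funD.
have F0 z : 0 <= F z <= 2 * opnorm O.
  by have := fb z; rewrite /F ler_norml => /andP[h1 h2]; apply/andP; split; lra.
have FL : coord_lipschitz (2 * opnorm O * t * delta) F.
  by move=> z i x y; rewrite /F opprD addrACA subrr addr0; exact: fL.
have b0 : 0 <= 2 * opnorm O * t * delta.
  exact: mulr_ge0 (mulr_ge0 (mulr_ge0 (ler0n _ 2) (opnorm_ge0 _)) t0) (ltW delta0).
have mS := measurable_sample theta.
have [m hm _] := bounded_integral P (measurableT_comp mF mS) (fun w => F0 (sample theta w)).
(* The trace is real because [rho] and the evolved observable are Hermitian; the complex modulus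
   thus becomes an absolute value. *)
have XE w : X w = cplx (f (sample theta w)).
  have HE : H + \sum_(i < M) Complex (g i w) 0 *: V i = noisy_hamiltonian H V chi (sample theta w).
    by congr (_ + _); apply: eq_bigr => i _; rewrite tnth_mktuple.
  have Im0 : complex.Im (X w) = 0.
    apply: Im_trace_hermitian; first by case: hrho.
    by apply: heisenberg_hermitian => //; rewrite HE; exact: noisy_hamiltonian_hermitian.
  by apply/eqP; rewrite eq_complex Im0 eqxx andbT fE /noisy_mean -HE.
have EXE : EX = cplx (m - opnorm O).
  rewrite /EX expectation.unlock.
  under eq_integral do rewrite XE /=.
  under [X in Complex _ (fine X)]eq_integral do rewrite XE /=.
  rewrite integral0 /cplx; congr Complex.
  have -> : (\int[P]_w (f (sample theta w))%:E = \int[P]_w ((F (sample theta w))%:E - (opnorm O)%:E))%E.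
    by apply: eq_integral => w _; rewrite /F -EFinB addrK.
  rewrite (integralB_EFin (f1 := fun w => F (sample theta w)) (f2 := fun=> opnorm O))//.
  - by rewrite hm integral_cst_probability.
  - apply/integrableP; split; first by apply/measurable_EFinP; exact: measurableT_comp mF mS.
    under eq_integral => w _.
      rewrite /= ger0_norm; last by have /andP[] := F0 (sample theta w).
      over.
    by rewrite hm ltry.
  - exact: finite_measure_integrable_cst.
have := concentration indep (fun i c => std_normal_mgf c (htheta i)) mF F0 FL b0 hm a0.
rewrite [a ^+ 2 / 4]mulrC => h; apply: (le_trans h).
(* No constant is lost here: with b = 2 |O| t delta, the threshold a b sqrt M is exactly the stated
   one, and the two events coincide. *)
rewrite le_eqVlt; apply/orP; left; apply/eqP; congr (P _); apply: eq_set => w.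
have -> : X w - EX = cplx (F (sample theta w) - m).
  by rewrite XE EXE /F; complex_ring.
rewrite cabs_cplx.
by congr (is_true (_ <= _)); ring.
Qed.
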